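(* Let $\rho$ and $\mu$ be Borel probability measures on $\mathbb{R}^d$ such that $\operatorname{spt}\rho$ is rectifiably connected and $\operatorname{spt}\mu$ is bounded. Suppose that $c\in\mathcal{C}^1(\mathbb{R}^d\times\mathbb{R}^d)$ and that there exist real-valued upper semi-continuous functions $a\in L^1(\rho)$ and $b\in L^1(\mu)$ such that $$\forall (x,y)\in\mathbb{R}^d\times\mathbb{R}^d,\quad |c(x,y)|\le a(x)+b(y).$$ Then optimisers of the dual optimal transport problem $$\max_{\substack{(\phi,\psi)\in L^1(\rho)\times L^1(\mu)\\ \phi\oplus\psi\le c}}\int_{\mathbb{R}^d}\phi\,\mathrm{d}\rho+\int_{\mathbb{R}^d}\psi\,\mathrm{d}\mu$$ exist and are unique up to a constant $\rho$- and $\mu$-a.e.: if $(\phi_0,\psi_0)$ and $(\phi_1,\psi_1)$ are two optimisers, there is $l\in\mathbb{R}$ with $\phi_0-\phi_1=l$ $\rho$-a.e. and $\psi_0-\psi_1=-l$ $\mu$-a.e.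
   Context: $\operatorname{spt}$ denotes the support of a measure. A set $\Omega\subseteq\mathbb{R}^d$ is rectifiably connected if for any $x,x'\in\Omega$ there exists $\omega\in W^{1,1}([0,1];\Omega)$ (an absolutely continuous curve with values in $\Omega$) with $\omega(0)=x'$ and $\omega(1)=x$. In the dual problem, potentials are pointwise defined measurable functions $\phi,\psi:\mathbb{R}^d\to\mathbb{R}\cup\{-\infty\}$ that are integrable with respect to $\rho$, respectively $\mu$; the constraint $\phi\oplus\psi\le c$ means $\phi(x)+\psi(y)\le c(x,y)$ for all $(x,y)\in\mathbb{R}^d\times\mathbb{R}^d$. *)

(* Defs.v *)
From HB Require Import structures.
From mathcomp Require Import all_boot all_order all_algebra.
From mathcomp Require Import all_classical all_reals all_analysis.
Set Implicit Arguments.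
Unset Strict Implicit.
Unset Printing Implicit Defensive.
Import Order.TTheory GRing.Theory Num.Theory.
Import numFieldNormedType.Exports.

Local Open Scope classical_set_scope.
Local Open Scope ring_scope.

(* R^d is 'rV[R]_d. The library gives it the sup norm, which is equivalent to
   the Euclidean one, and no sigma-algebra: [borel V] is V with the one
   generated by its open sets. *)
Notation borel V := (g_sigma_algebraType (@open V)).

Section topology.
Context {R : realType} {T : topologicalType}.

Definition upper_semicontinuous (f : T -> R) : Prop :=
  forall x r, f x < r -> \forall y \near x, f y < r.

Definition spt (mu : set T -> \bar R) : set T :=
  [set x | forall U : set T, open U -> U x -> (0 < mu U)%E].

End topology.

Section curves.
Context {R : realType} {V : normedModType R}.

Definition absolutely_continuous (a b : R) (f : R -> V) : Prop :=
  forall e : R, 0 < e -> exists2 delta : R, 0 < delta &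
    forall (n : nat) (s t : 'I_n -> R),
      (forall i, a <= s i /\ s i <= t i /\ t i <= b) ->
      trivIset [set: 'I_n] (fun i => `]s i, t i[%classic) ->
      \sum_(i < n) (t i - s i) < delta ->
      \sum_(i < n) `|f (t i) - f (s i)| < e.

(* W^{1,1}([0,1]; Omega) is the set of absolutely continuous curves in Omega. *)
Definition rectifiably_connected (Omega : set V) : Prop :=
  forall x x', Omega x -> Omega x' ->
    exists omega : R -> V,
      [/\ absolutely_continuous 0 1 omega,
          forall t, 0 <= t <= 1 -> Omega (omega t),
          omega 0 = x' & omega 1 = x].

End curves.

(* f is differentiable everywhere, and z |-> 'd f z is continuous for the
   operator norm. *)
Definition C1 {R : realType} {V W : normedModType R} (f : V -> W) : Prop :=
  (forall z, differentiable f z) /\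
  (forall z (e : R), 0 < e ->
     \forall z' \near z, forall v, `|'d f z' v - 'd f z v| <= e * `|v|).

Section dual_problem.
Context {R : realType} {d : nat}.
Local Notation E := 'rV[R]_d.
Variables (c : E * E -> R) (rho mu : probability (borel E) R).
Local Open Scope ereal_scope.

(* [nu.-integrable] includes measurability. *)
Definition potential (nu : probability (borel E) R) (phi : E -> \bar R) : Prop :=
  nu.-integrable [set: E] phi /\ (forall x, phi x < +oo).

Definition dual_admissible (phi psi : E -> \bar R) : Prop :=
  [/\ potential rho phi, potential mu psi &
      forall x y, phi x + psi y <= (c (x, y))%:E].

Definition dual_value (phi psi : E -> \bar R) : \bar R :=
  \int[rho]_x phi x + \int[mu]_y psi y.

Definition dual_optimiser (phi psi : E -> \bar R) : Prop :=
  dual_admissible phi psi /\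
  (forall phi' psi', dual_admissible phi' psi' ->
     dual_value phi' psi' <= dual_value phi psi).

End dual_problem.

(* Main.v *)
(* Let K be the support of mu, which is compact, and replace phi by the
   c-transform F x = inf_(y in K) (c (x, y) - psi y) of psi: it is finite,
   continuous, dominates phi, and inherits from c a modulus of continuity and,
   after subtracting F 0, a bound a + cst, both independent of psi.

   Existence.  Along a maximising sequence, the normalised c-transforms are
   thus pointwise bounded and equicontinuous, so a subsequence converges
   pointwise; the limit superior of the second potentials is admissible with
   this limit.  Dominated convergence for the first potentials and Fatou's lemma
   for the second ones, which are bounded above by a 0 + b, conclude.

   Uniqueness.  No optimal plan is needed: the average of two optimal pairs is
   optimal, and a point y of K that is optimal in the c-transform of the average
   at x is in contact with x for both pairs.  Such a y exists for every x in the
   support of rho, so that F0 and F1 are touched from above at x by the same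
   function c (., y) + cst.  Along a Lipschitz curve w in the support of rho (an
   absolutely continuous one, reparametrised by total variation), F0 o w and
   F1 o w are Lipschitz and have the same derivative wherever it exists.  Instead
   of Rademacher's theorem, this is exploited with finite sums: at dyadic
   midpoints, the second differences of a Lipschitz function have a sum that
   tends to 0, because dyadic slopes form a martingale bounded in L^2; hence the
   forward increments of F0 o w and the backward ones of F1 o w can be compared
   through the common contact function.  So F0 - F1 is a constant l on the
   support of rho, and optimality of (phi0, psi0) against
   (F0, max (psi0, psi1 - l)) gives psi1 - l <= psi0 a.e., and symmetrically. *)
Require Import Defs.
From HB Require Import structures.
From mathcomp Require Import all_boot all_order all_algebra.
From mathcomp Require Import all_classical all_reals all_analysis.
From mathcomp Require Import measurable_realfun ring lra.
Set Implicit Arguments.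
Unset Strict Implicit.
Unset Printing Implicit Defensive.
Import Order.TTheory GRing.Theory Num.Theory.
Import numFieldNormedType.Exports.

Local Open Scope classical_set_scope.
Local Open Scope ring_scope.

(** * Second differences at dyadic midpoints *)

Section dyadic.
Context {R : realType}.
Implicit Types (u : R -> R) (n : nat).

Definition dyad n k : R := k%:R / 2 ^+ n.

Lemma dyad_itv n k : (k <= 2 ^ n)%N -> 0 <= dyad n k <= 1.
Proof.
move=> kn; rewrite /dyad divr_ge0 ?exprn_ge0 ?ler0n//=.
by rewrite ler_pdivrMr ?exprn_gt0// mul1r -natrX ler_nat.
Qed.

Lemma dyad_double n k : dyad n.+1 (k.*2) = dyad n k.
Proof.
rewrite /dyad exprS -muln2 natrM mulrC invfM.
have h : (2 ^+ n : R) != 0 by rewrite expf_neq0// pnatr_eq0.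
by field.
Qed.

Lemma dyadS n k : dyad n k.+1 - dyad n k = (2 ^+ n)^-1.
Proof. by rewrite /dyad -mulrBl -natr1 addrAC subrr add0r mul1r. Qed.

Lemma sum_double (V : nmodType) (F : nat -> V) N :
  \sum_(k < N.*2) F k = \sum_(k < N) (F k.*2 + F k.*2.+1).
Proof.
elim: N => [|N IH]; first by rewrite !big_ord0.
by rewrite doubleS !big_ord_recr/= IH addrA.
Qed.

(** Second difference at the midpoint of the [k]-th dyadic interval of level [n]. The target is any
    [zmodType], since both potentials along a curve and the curve itself are measured this way. *)
Definition mid_diff2 (V : zmodType) (u : R -> V) n k : V :=
  (u (dyad n.+1 k.*2.+2) - u (dyad n.+1 k.*2.+1)) -
  (u (dyad n.+1 k.*2.+1) - u (dyad n.+1 k.*2)).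

(** Squared L^2 norm of the step function formed by the slopes of [u] at level [n]: each term is the
    squared slope times the length [2^-n]. *)
Definition dyadic_energy u n : R :=
  \sum_(k < 2 ^ n) (u (dyad n k.+1) - u (dyad n k)) ^+ 2 * 2 ^+ n.

(* The slopes on dyadic intervals form a martingale; the energy gap is the
   square norm of its increment. *)
Lemma dyadic_energyS u n : dyadic_energy u n.+1 =
  dyadic_energy u n + \sum_(k < 2 ^ n) (mid_diff2 u n k) ^+ 2 * 2 ^+ n.
Proof.
rewrite /dyadic_energy expnS mul2n.
rewrite (sum_double (fun k => (u (dyad n.+1 k.+1) - u (dyad n.+1 k)) ^+ 2 * 2 ^+ n.+1)).
rewrite -big_split/=; apply: eq_bigr => k _.
rewrite /mid_diff2 -(dyad_double n k) -(dyad_double n k.+1) doubleS (exprS 2 n).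
by ring.
Qed.

(** The energy is nondecreasing and at most [C ^+ 2] once the mesh is below [del], so its increments
    tend to 0; AM-GM converts these sums of squares into sums of absolute values. The Lipschitz
    bound is local because potentials are controlled only at small scale. *)
Lemma sum_mid_diff2_small u (C del : R) : 0 < del ->
  (forall s t, 0 <= s <= 1 -> 0 <= t <= 1 -> `|s - t| < del ->
    `|u s - u t| <= C * `|s - t|) ->
  forall e, 0 < e -> \forall n \near \oo,
    \sum_(k < 2 ^ n) `|mid_diff2 u n k| <= e.
Proof.
move=> del0 ulip e e0.
have small : \forall n \near \oo, (2 ^+ n)^-1 < del.
  have : (2^-1 : R) ^+ n @[n --> \oo] --> 0.
    by apply: cvg_expr; rewrite ger0_norm ?invr_ge0// invf_lt1// ltr1n.
  move=> /cvgr0Pnorm_lt/(_ _ del0); apply: filterS => n.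
  by rewrite exprVn ger0_norm// invr_ge0 exprn_ge0.
have bnd : \forall n \near \oo, dyadic_energy u n <= C ^+ 2.
  apply: filterS small => n hn.
  have p0 : (0 : R) < 2 ^+ n by rewrite exprn_gt0.
  have -> : C ^+ 2 = \sum_(k < 2 ^ n) (C / 2 ^+ n) ^+ 2 * 2 ^+ n.
    rewrite sumr_const card_ord -[RHS]mulr_natr natrX.
    by field; rewrite gt_eqF.
  have inc k : (k < 2 ^ n)%N ->
      `|u (dyad n k.+1) - u (dyad n k)| <= C / 2 ^+ n.
    move=> kn; have := ulip (dyad n k.+1) (dyad n k).
    rewrite dyadS ger0_norm ?invr_ge0 ?(ltW p0)//; apply => //.
      exact: dyad_itv.
    by apply: dyad_itv; exact: ltnW.
  apply: ler_sum => k _; rewrite ler_pM2r//.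
  rewrite -[leLHS]real_normK ?num_real// ler_pXn2r ?nnegrE//; first exact: inc.
  exact: le_trans (normr_ge0 _) (inc k (ltn_ord k)).
have ndE : nondecreasing_seq (dyadic_energy u).
  apply/nondecreasing_seqP => n; rewrite dyadic_energyS lerDl.
  by apply: sumr_ge0 => k _; rewrite mulr_ge0 ?sqr_ge0// exprn_ge0.
have ubE : has_ubound (range (dyadic_energy u)).
  (* The bound holds only from rank [N] on; monotonicity carries it back to the smaller ranks. *)
  have [N _ hN] := bnd.
  exists (C ^+ 2) => _ [n _ <-].
  apply: le_trans (hN (maxn n N) (leq_maxr _ _)).
  by apply: ndE; exact: leq_maxl.
have /nondecreasing_cvgn/(_ ubE) cvE := ndE.
have gap0 : dyadic_energy u n.+1 - dyadic_energy u n @[n --> \oo] --> 0.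
  rewrite -(subrr (sup (range (dyadic_energy u)))).
  apply: cvgB => //.
  by move: cvE; rewrite -(cvg_shiftS (dyadic_energy u)).
have e2 : 0 < e ^+ 2 / 4 by rewrite divr_gt0// exprn_gt0.
move/cvgr0Pnorm_lt : gap0 => /(_ _ e2); apply: filterS => n.
rewrite dyadic_energyS addrAC subrr add0r -mulr_suml => hn.
have p0 : (0 : R) < 2 ^+ n by rewrite exprn_gt0.
(* AM-GM: [|x| <= (e / 2) / 2^n + x^2 2^n / (e / 2)] *)
have key k : `|mid_diff2 u n k| <=
    (e / 2) / 2 ^+ n + (mid_diff2 u n k ^+ 2 * 2 ^+ n) / (e / 2).
  set x := `|_|; have -> : mid_diff2 u n k ^+ 2 = x ^+ 2.
    by rewrite /x real_normK// num_real.
  rewrite -subr_ge0; set y := (X in 0 <= X).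
  have -> : y = ((x * 2 ^+ n - e / 4) ^+ 2 + 3 * (e / 4) ^+ 2) / (2 ^+ n * (e / 2)).
    by rewrite /y; field; rewrite !gt_eqF.
  rewrite divr_ge0// ?mulr_ge0// ?divr_ge0 ?(ltW p0) ?(ltW e0)//.
  by rewrite addr_ge0 ?sqr_ge0// mulr_ge0// sqr_ge0.
apply: le_trans; first by apply: ler_sum => k _; exact: key.
rewrite big_split/= -!mulr_suml sumr_const card_ord -[e *+ _]mulr_natr natrX.
rewrite [X in X + _](_ : _ = e / 2); last by field; rewrite gt_eqF.
rewrite -[leRHS](@divfK _ 2)// mulr_natr mulr2n lerD2l.
rewrite ler_pdivrMr ?divr_gt0//.
apply: le_trans (ler_norm _) _; apply: le_trans (ltW hn) _.
by rewrite le_eqVlt; apply/orP; left; apply/eqP; field.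
Qed.

End dyadic.

(** * Uniform first-order expansion of the cost on compact sets *)

Section strict_differentiability.
Context {R : realType} {V W : normedModType R}.
Implicit Types (c : V * W -> R).

Lemma is_derive_segment c (w v : V * W) (t : R) :
  differentiable c (w + t *: v) ->
  is_derive t 1 (fun s : R => c (w + s *: v)) ('d c (w + t *: v) v).
Proof.
move=> dc; have cv := @diff_derivable R _ _ c (w + t *: v) v dc.
pose g (s : R) := c (w + s *: v).
have E : (fun h : R => h^-1 *: ((c \o shift (w + t *: v)) (h *: v) - c (w + t *: v)))
       = (fun h : R => h^-1 *: ((g \o shift t) (h *: 1) - g t)).
  by apply/funext => h; rewrite /g /= [h *: 1]mulr1 scalerDl addrCA.
rewrite -deriveE//; split; first by move: cv; rewrite /derivable E.
by rewrite /derive E.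
Qed.

(** Mean value theorem on the segment from [p.1] to [z], after subtracting the linear part. The
    differential is frozen at the centre [(x0, y0)], so that one linear map serves all nearby base
    points, as the covering argument below requires. *)
Lemma C1_strict c (x0 : V) (y0 : W) (e : R) : C1 c -> 0 < e ->
  \forall p \near (x0, y0) & r \near (0 : R)^'+, forall z, `|z - p.1| < r ->
    `|c (z, p.2) - c p - 'd c (x0, y0) (z - p.1, 0)| <= e * `|z - p.1|.
Proof.
move=> [dc cdc] e0.
have [r /= r0 rP] := (nbhs_ballP _ _).1 (cdc (x0, y0) e e0).
exists (ball (x0, y0) (r / 2), [set s | s < r / 2]) => /=.
  split; first by apply: nbhsx_ballx; rewrite divr_gt0.
  by near=> s => /=; near: s; apply: nbhs_right_lt; rewrite divr_gt0.
move=> [[x y] s] /= [xy sr] z zx.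
set v := z - x; set w := (x, y).
pose h (t : R) := c (w + t *: (v, 0)) - t * 'd c (x0, y0) (v, 0).
pose dh (t : R) := 'd c (w + t *: (v, 0)) (v, 0) - 'd c (x0, y0) (v, 0).
have dhP (t : R) : is_derive t 1 h (dh t).
  apply: is_deriveB; first exact: is_derive_segment.
  by apply: is_derive_eq; rewrite scaler0 add0r [_ *: _]mulr1.
have [|t t01] := @MVT_segment R h dh 0 1 ler01 (fun t _ => dhP t).
  apply: continuous_subspaceT => t.
  by apply/differentiable_continuous/derivable1_diffP; case: (dhP t).
rewrite /h scale0r addr0 mul0r subr0 scale1r mul1r subr0 mulr1.
have -> : w + (v, 0) = (z, y).
  by rewrite /w /v; congr pair => /=; rewrite ?addr0// addrC subrK.
rewrite addrAC => ->; rewrite /dh.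
have -> : `|v| = `|(v, 0 : W)|.
  by rewrite prod_normE/= normr0; apply/esym/max_idPl.
apply: (rP).
case: xy => /= bx by_; split => /=.
- rewrite -ball_normE/=.
  have -> : x0 - (x + t *: v) = (x0 - x) - t *: v by rewrite opprD addrA.
  apply: le_lt_trans (ler_normB _ _) _.
  rewrite [ltRHS](splitr r) ltrD//; first by move: bx; rewrite -ball_normE.
  rewrite normrZ; apply: le_lt_trans (lt_trans zx sr).
  move: t01; rewrite in_itv/= => /andP[t0 t1].
  by rewrite ger0_norm// ler_piMl.
- rewrite scaler0 addr0; apply: le_ball by_.
  by rewrite ler_pdivrMr// ler_peMr ?(ltW r0)// ler1n.
Unshelve. all: by end_near. Qed.

(** Covering [A] and [B] by neighbourhoods given by [C1_strict]. The map [P] is a partial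
    differential at a neighbouring centre; additivity and a uniform bound are all that is used of
    it. *)
Lemma C1_uniformly_strict c (A : set V) (B : set W) (e : R) : C1 c ->
  compact A -> compact B -> 0 < e ->
  exists r M : R, [/\ 0 < r, 0 < M & forall x y, A x -> B y ->
    exists P : V -> R, [/\ forall v w, P (v - w) = P v - P w,
      forall v, `|P v| <= M * `|v| &
      forall z, `|z - x| < r ->
        `|c (z, y) - c (x, y) - P (z - x)| <= e * `|z - x|]].
Proof.
move=> cC1 cA cB e0.
(* [r] is both the radius and, through its inverse, the bound on [P]: shrinking it weakens both
   demands, so one parameter tending to 0 suffices. *)
pose good (r : R) (p : V * W) := exists P : V -> R,
  [/\ forall v w, P (v - w) = P v - P w, forall v, `|P v| <= r^-1 * `|v| &
      forall z, `|z - p.1| < r ->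
        `|c (z, p.2) - c p - P (z - p.1)| <= e * `|z - p.1|].
have good_near : \forall r \near (0 : R)^'+, A `*` B `<=` good r.
  have /compact_near_coveringP/(_ _ (0 : R)^'+ good) := compact_setX cA cB.
  apply => -[x0 y0] _.
  have dc0 : continuous ('d c (x0, y0)) by apply: diff_continuous; exact: cC1.1.
  have /linear_boundedP : bounded_near ('d c (x0, y0)) (nbhs 0).
    exact/linear_bounded_continuous.
  move=> [M [_ MP]].
  have := C1_strict x0 y0 cC1 e0; apply: filter_app.
  exists (setT, [set s : R | 0 < s /\ s < (`|M| + 1)^-1]) => /=.
    split; first exact: filterT.
    near=> s => /=; split; near: s; first exact: nbhs_right_gt.
    by apply: nbhs_right_lt; rewrite invr_gt0 ltr_wpDl.
  move=> [p s] /= [_ [s0 sM]] h; exists (fun v => 'd c (x0, y0) (v, 0)); split => //.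
  + by move=> v w; rewrite -linearB; congr ('d c _ (_, _)) => /=; rewrite subr0.
  + move=> v; have -> : `|v| = `|(v, 0 : W)|.
      by rewrite prod_normE/= normr0; apply/esym/max_idPl.
    apply: MP; apply: (le_lt_trans (ler_norm M)).
    apply: (lt_trans (_ : _ < `|M| + 1)); first by rewrite ltrDl.
    by rewrite -[ltLHS]invrK ltf_pV2 ?posrE ?invr_gt0// ltr_wpDl.
have [r [r0 rP]] : exists r, 0 < r /\ A `*` B `<=` good r.
  apply: (@filter_ex _ (0 : R)^'+); near=> r; split; near: r => //.
  exact: nbhs_right_gt.
exists r, r^-1; split => //; first by rewrite invr_gt0.
by move=> x y Ax By; exact: (rP (x, y)).
Unshelve. all: by end_near. Qed.

End strict_differentiability.

(** * Potentials along curves *)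

Section curves.
Context {R : realType} {d : nat}.
Local Notation E := 'rV[R]_d.

Lemma normr_rV_le_sum (v : E) : `|v| <= \sum_j `|v ord0 j|.
Proof.
rewrite [leLHS]/Num.norm/= mx_normrE; apply/bigmax_leP; split.
  by apply: sumr_ge0.
move=> [i j] _ /=; rewrite (ord1 i) (bigD1 j)//= lerDl.
by apply: sumr_ge0.
Qed.

Lemma coord_normr_le (v : E) j : `|v ord0 j| <= `|v|.
Proof.
rewrite [leRHS]/Num.norm/= mx_normrE.
by apply/bigmax_geP; right; exists (ord0, j).
Qed.

Lemma compact_norm_le (M : R) : compact [set v : E | `|v| <= M].
Proof.
apply: bounded_closed_compact.
  by exists M; split; [exact: num_real|move=> N MN v /= /le_trans; apply; exact: ltW].
rewrite [X in closed X](_ : _ = (fun v : E => `|v|) @^-1` [set x : R | x <= M])//.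
by apply: closed_comp => [v _|]; [exact: norm_continuous|exact: closed_le].
Qed.

(** At the midpoint [m] of a dyadic interval with ends [a] and [b], one contact function bounds the
    increment of [F] from [m] to [b] above, and that of [G] from [a] to [m] below, by the same
    linear map applied to increments of [w]. Up to second differences of [F], [G] and [w], these are
    half of the increments over the whole interval, and the second differences have small sums. *)
Lemma potential_diff_le_along_curve (c : E * E -> R) (K : set E)
    (F G : E -> R) (w : R -> E) (C : R) :
  C1 c -> compact K -> 0 < C ->
  (forall s t, 0 <= s <= 1 -> 0 <= t <= 1 -> `|w s - w t| <= C * `|s - t|) ->
  (forall t, 0 <= t <= 1 -> exists2 y, K y & forall z,
     F z - F (w t) <= c (z, y) - c (w t, y) /\
     G z - G (w t) <= c (z, y) - c (w t, y)) ->
  F (w 1) - G (w 1) <= F (w 0) - G (w 0).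
Proof.
move=> cC1 cK C0 wlip contact.
(* A closed ball containing the curve, for the compactness argument. *)
pose A := [set v : E | `|v| <= `|w 0| + C].
have wA t : 0 <= t <= 1 -> A (w t).
  move=> t01; rewrite /A/= -[w t](subrK (w 0)) addrC.
  apply: (le_trans (ler_normD _ _)); rewrite lerD2l.
  apply: (le_trans (wlip t 0 t01 _)); first by rewrite lexx ler01.
  rewrite subr0; case/andP : t01 => t0 t1.
  by rewrite ger0_norm// ler_piMr// ltW.
have cA : compact A by exact: compact_norm_le.
(* Contact at [w t] bounds the increment from one side, contact at [w s] from the other; hence a
   Lipschitz constant [(M + 1) * C] at scale [r / C]. *)
have lip (H : E -> R) : (forall t, 0 <= t <= 1 -> exists2 y, K y & forall z,
     H z - H (w t) <= c (z, y) - c (w t, y)) ->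
  forall e, 0 < e -> \forall n \near \oo,
    \sum_(k < 2 ^ n) `|mid_diff2 (H \o w) n k| <= e.
  move=> Hc.
  have [r [M [r0 M0 rP]]] := C1_uniformly_strict cC1 cA cK (@ltr01 R).
  apply: (@sum_mid_diff2_small _ _ ((M + 1) * C) (r / C)).
    by rewrite divr_gt0.
  have one_sided s t : 0 <= s <= 1 -> 0 <= t <= 1 -> `|s - t| < r / C ->
      H (w s) - H (w t) <= (M + 1) * C * `|s - t|.
    move=> s01 t01 st; have [y Ky yP] := Hc _ t01.
    have [P [_ PM PP]] := rP _ _ (wA _ t01) Ky.
    apply: (le_trans (yP _)).
    have wst := wlip _ _ s01 t01.
    have /PP : `|w s - w t| < r.
      by rewrite (le_lt_trans wst)// mulrC -ltr_pdivlMr.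
    move=> /ler_normlP[_]; rewrite lerBlDr => /le_trans; apply.
    rewrite mul1r; apply: (@le_trans _ _ ((M + 1) * `|w s - w t|)).
      rewrite mulrDl mul1r addrC lerD2r.
      by apply: le_trans (PM _); exact: ler_norm.
    by rewrite -mulrA ler_pM2l// addr_gt0.
  move=> s t s01 t01 st; apply/ler_normlP; split => /=.
    by rewrite opprB distrC; apply: one_sided => //; rewrite distrC.
  exact: one_sided.
have Fs := lip F ltac:(by move=> t /contact[y Ky yP]; exists y => // z; case: (yP z)).
have Gs := lip G ltac:(by move=> t /contact[y Ky yP]; exists y => // z; case: (yP z)).
have ws (j : 'I_d) : forall e, 0 < e -> \forall n \near \oo,
    \sum_(k < 2 ^ n) `|mid_diff2 (fun t => w t ord0 j) n k| <= e.
  apply: (@sum_mid_diff2_small _ _ C 1) => // s t s01 t01 _.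
  by apply: le_trans (wlip _ _ s01 t01); have := coord_normr_le (w s - w t) j; rewrite !mxE.
apply/ler_addgt0Pr => e e0.
(* Each of four errors gets [e / 4]: linearising [c] (through [e']), and the second differences of
   [w] (through [ew], shared among the coordinates), of [F o w] and of [G o w]. The factor [d.+1] in
   [ew] avoids dividing by 0 when [d = 0]. *)
pose e' := e / (8 * C).
have e'0 : 0 < e' by rewrite divr_gt0// mulr_gt0.
have [r [M [r0 M0 rP]]] := C1_uniformly_strict cC1 cA cK e'0.
pose ew := e / (8 * M * d.+1%:R).
have ew0 : 0 < ew by rewrite divr_gt0// !mulr_gt0.
have e4 : 0 < e / 4 by rewrite divr_gt0.
have small : \forall n \near \oo, C * (2 ^+ n.+1)^-1 < r.
  have : C * (2^-1 : R) ^+ n.+1 @[n --> \oo] --> C * 0.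
    apply: cvgMl_tmp; rewrite (cvg_shiftS (fun n => (2^-1 : R) ^+ n)).
    by apply: cvg_expr; rewrite ger0_norm ?invr_ge0// invf_lt1// ltr1n.
  rewrite mulr0 => /cvgr0Pnorm_lt/(_ _ r0); apply: filterS => n.
  by rewrite exprVn; apply: le_lt_trans; exact: ler_norm.
have [n [nr nF nG nw]] : exists n, [/\ C * (2 ^+ n.+1)^-1 < r,
    \sum_(k < 2 ^ n) `|mid_diff2 (F \o w) n k| <= e / 4,
    \sum_(k < 2 ^ n) `|mid_diff2 (G \o w) n k| <= e / 4 &
    forall j : 'I_d, \sum_(k < 2 ^ n) `|mid_diff2 (fun t => w t ord0 j) n k| <= ew].
  have nw : \forall n \near \oo, forall j : 'I_d,
      \sum_(k < 2 ^ n) `|mid_diff2 (fun t => w t ord0 j) n k| <= ew.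
    by apply: filter_forall => j; exact: ws.
  apply: (@filter_ex _ \oo); near=> n; split; near: n => //.
  - exact: Fs.
  - exact: Gs.
pose g t := F (w t) - G (w t).
have step k : (k < 2 ^ n)%N -> g (dyad n k.+1) - g (dyad n k) <=
    2 * M * `|mid_diff2 w n k| + 2 * e' * C * (2 ^+ n.+1)^-1 * 2 +
    `|mid_diff2 (F \o w) n k| + `|mid_diff2 (G \o w) n k|.
  move=> kn; rewrite -(dyad_double n k.+1) -(dyad_double n k) doubleS.
  have ha : 0 <= @dyad R n.+1 k.*2 <= 1.
    by apply: dyad_itv; rewrite expnS mul2n leq_double ltnW.
  have hm : 0 <= @dyad R n.+1 k.*2.+1 <= 1.
    by apply: dyad_itv; rewrite expnS mul2n ltn_double.
  have hb : 0 <= @dyad R n.+1 k.*2.+2 <= 1.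
    by apply: dyad_itv; rewrite expnS mul2n -doubleS leq_double.
  rewrite /mid_diff2 /=.
  have lb := @dyadS R n.+1 k.*2.+1; have la := @dyadS R n.+1 k.*2.
  move: lb la ha hm hb; set a := dyad _ k.*2; set b := dyad _ k.*2.+2; set m := dyad _ k.*2.+1.
  move=> lb la ha hm hb.
  set h := (2 ^+ n.+1)^-1 in nr lb la *.
  have h0 : 0 <= h by rewrite invr_ge0 exprn_ge0.
  have [y Ky yP] := contact _ hm.
  have [P [Padd PM PP]] := rP _ _ (wA _ hm) Ky.
  have near_m s : 0 <= s <= 1 -> `|s - m| = h ->
      c (w s, y) - c (w m, y) <= P (w s - w m) + e' * C * h.
    move=> s01 sm; have := wlip _ _ s01 hm; rewrite sm => ws'.
    have /PP : `|w s - w m| < r by exact: le_lt_trans nr.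
    move=> /ler_normlP[_]; rewrite lerBlDl => /le_trans; apply.
    by rewrite lerD2l -mulrA ler_pM2l.
  (* [F] is used to the right of the midpoint and [G] to the left, with the same [y] and [P]; the
     two values of [P] combine into [P] of the second difference of [w]. *)
  have Fb := le_trans (yP (w b)).1 (near_m b hb _).
  have Ga := le_trans (yP (w a)).2 (near_m a ha _).
  have {}Fb := Fb ltac:(by rewrite lb ger0_norm).
  have {}Ga := Ga ltac:(by rewrite distrC la ger0_norm).
  have P0 : P 0 = 0 by rewrite -(subrr 0) Padd subrr.
  have Pam : P (w a - w m) = - P (w m - w a).
    by rewrite -(opprB (w m)) -sub0r Padd P0 sub0r.
  have := PM ((w b - w m) - (w m - w a)); rewrite Padd.
  move=> /ler_normlP[_] PD.
  have := ler_norm (F (w b) - F (w m) - (F (w m) - F (w a))).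
  have := ler_norm (- (F (w b) - F (w m) - (F (w m) - F (w a)))).
  have := ler_norm (- (G (w b) - G (w m) - (G (w m) - G (w a)))).
  rewrite !normrN /g.
  set DF := `|_|; set DG := `|_|; set Dw := `|_| in PD *.
  move=> h1 h2 h3; lra.
have -> : F (w 1) - G (w 1) = g (dyad n (2 ^ n)).
  by rewrite /g /dyad natrX divff// expf_neq0.
have -> : F (w 0) - G (w 0) = g (dyad n 0) by rewrite /g /dyad mul0r.
rewrite addrC -lerBlDr -(telescope_sumr (fun k => g (dyad n k)))//.
rewrite big_mkord; apply: le_trans.
  by apply: ler_sum => k _; exact: step.
rewrite !big_split/= -!mulr_sumr.
rewrite sumr_const card_ord -[2 *+ 2 ^ n]mulr_natr natrX.
have wle : \sum_(k < 2 ^ n) `|mid_diff2 w n k| <= e / (8 * M).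
  apply: (@le_trans _ _ (\sum_(k < 2 ^ n) \sum_j `|mid_diff2 (fun t => w t ord0 j) n k|)).
    apply: ler_sum => k _; apply: (le_trans (normr_rV_le_sum _)).
    by apply: ler_sum => j _; rewrite /mid_diff2 !mxE.
  rewrite exchange_big/=; apply: le_trans.
    by apply: ler_sum => j _; exact: nw.
  rewrite sumr_const card_ord -[ew *+ d]mulr_natr /ew.
  have -> : e / (8 * M * d.+1%:R) * d%:R = e / (8 * M) * (d%:R / d.+1%:R).
    by field; rewrite (gt_eqF M0) andbT nat1r pnatr_eq0.
  by rewrite ger_pMr ?divr_gt0 ?mulr_gt0// ler_pdivrMr// mul1r ler_nat.
have {}wle : 2 * M * \sum_(k < 2 ^ n) `|mid_diff2 w n k| <= e / 4.
  rewrite -ler_pdivlMl ?mulr_gt0//; apply: (le_trans wle).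
  by rewrite le_eqVlt; apply/orP; left; apply/eqP; field; rewrite gt_eqF.
have -> : 2 * e' * C * (2 ^+ n.+1)^-1 * (2 * 2 ^+ n) = e / 4.
  by rewrite /e' exprS; field; rewrite !gt_eqF// exprn_gt0.
lra.
Unshelve. all: by end_near. Qed.

End curves.

(** * Lipschitz reparametrisation of absolutely continuous curves *)

Section absolutely_continuous_curves.
Context {R : realType}.

Lemma absolutely_continuous_dist {V : normedModType R} (f : R -> V) e :
  absolutely_continuous 0 1 f -> 0 < e -> exists2 del, 0 < del &
    forall s t, 0 <= s <= 1 -> 0 <= t <= 1 -> `|s - t| < del -> `|f s - f t| < e.
Proof.
move=> acf e0; have [del del0 H] := acf e e0; exists del => // s t.
wlog st : s t / s <= t.
  move=> W s01 t01; have [|/ltW] := leP s t; first by move=> ?; exact: W.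
  by move=> ts; rewrite distrC (distrC (f s)); exact: W.
move=> /andP[s0 s1] /andP[t0 t1]; rewrite distrC ger0_norm ?subr_ge0// => dst.
have := H 1 (fun=> s) (fun=> t); rewrite !big_ord1 distrC; apply => //.
by move=> i j _ _ _; rewrite !ord1.
Qed.

Lemma absolutely_continuous_within (f : R -> R) :
  absolutely_continuous 0 1 f -> {within `[0, 1], continuous f}.
Proof.
move=> acf; apply/subspace_continuousP => x /=; rewrite in_itv/= => x01.
apply/cvgrPdist_lt => e e0.
have [del del0 H] := absolutely_continuous_dist acf e0.
rewrite near_withinE; near=> t => /= t01; apply: H; [by []|by move: t01; rewrite in_itv|].
by near: t; exact: cvgr_dist_lt.
Unshelve. all: by end_near. Qed.

(** With [del] associated with the error 1, the variation on an interval shorter than [del] is at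
    most 1; finitely many such intervals cover [[0, 1]], and the variation is additive. *)
Lemma absolutely_continuous_bounded_variation (f : R -> R) :
  absolutely_continuous 0 1 f -> bounded_variation 0 1 f.
Proof.
move=> acf; have [del del0 H] := acf 1 ltr01.
have short a b : 0 <= a -> a <= b -> b <= 1 -> b - a < del ->
    bounded_variation a b f.
  move=> a0 ab b1 abdel; exists 1 => _ [s ps <-].
  set F := nth b (a :: s).
  have Fmono : forall k, (k < size s)%N -> F k <= F k.+1.
    exact: (@nondecreasing_fun_itv_partition _ _ a b id s).
  have Fle i j : (i <= j)%N -> (j <= size s)%N -> F i <= F j.
    elim: j => [|j IH]; first by rewrite leqn0 => /eqP ->.
    rewrite leq_eqVlt => /predU1P[->//|]; rewrite ltnS => ij js.
    by apply: le_trans (Fmono _ js); apply: IH => //; exact: ltnW.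
  have := H (size s) (fun i => F i) (fun i => F i.+1).
  rewrite -(big_mkord xpredT (fun i => F i.+1 - F i)) telescope_sumr//.
  rewrite -(big_mkord xpredT (fun i => `|f (F i.+1) - f (F i)|)).
  have -> : F (size s) = b by exact: itv_partition_nth_size.
  move=> W; apply/ltW/W => //.
  - move=> i; split; last split; last first.
    + by apply: le_trans b1; apply: itv_partition_nth_le => //; rewrite ltnS.
    + exact: Fmono.
    + by apply: le_trans a0 _; apply: itv_partition_nth_ge => //; rewrite ltnS ltnW.
  - move=> i j _ _ [x [/=]]; rewrite !in_itv/= => /andP[ix xi] /andP[jx xj].
    apply/val_inj; case: (ltngtP i j) => // ij.
    + have := Fle _ _ ij (ltnW (ltn_ord _)).
      by rewrite leNgt (lt_trans jx xi).
    + have := Fle _ _ ij (ltnW (ltn_ord _)).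
      by rewrite leNgt (lt_trans ix xj).
have [n nP] : exists n : nat, del^-1 < n%:R.
  by exists (Num.truncn del^-1).+1; exact: truncnS_gt.
have n0 : (0 : R) < n%:R by apply: lt_trans nP; rewrite invr_gt0.
suff BVk k : (k <= n)%N -> bounded_variation 0 (k%:R / n%:R) f.
  by have := BVk _ (leqnn n); rewrite divff// gt_eqF.
have kn01 i : 0 <= i%:R / n%:R :> R by rewrite divr_ge0.
elim: k => [_|k IH kn]; first by rewrite mul0r; exact: bounded_variationxx.
have kk : k%:R / n%:R <= k.+1%:R / n%:R :> R by rewrite ler_pM2r ?invr_gt0// ler_nat.
apply/bounded_variationP => //; rewrite (total_variationD _ (kn01 k) kk) fin_numD.
apply/andP; split; first by apply/bounded_variationP => //; exact/IH/ltnW.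
apply/bounded_variationP => //; apply: short => //.
  by rewrite ler_pdivrMr// mul1r ler_nat.
by rewrite -mulrBl -natrB// subSnn mul1r -[ltRHS]invrK ltf_pV2 ?posrE ?invr_gt0.
Qed.

Variable d : nat.
Local Notation E := 'rV[R]_d.

(* The total variation of the coordinates is used as the new parameter. *)
Lemma absolutely_continuous_reparam (w : R -> E) : absolutely_continuous 0 1 w ->
  exists (tau : R -> R) (C : R), [/\ 0 < C,
    forall s, 0 <= s <= 1 -> 0 <= tau s <= 1,
    forall s t, 0 <= s <= 1 -> 0 <= t <= 1 ->
      `|w (tau s) - w (tau t)| <= C * `|s - t|,
    w (tau 0) = w 0 & w (tau 1) = w 1].
Proof.
move=> acw; pose f (j : 'I_d) t := w t ord0 j.
have acf j : absolutely_continuous 0 1 (f j).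
  move=> e e0; have [del del0 H] := acw e e0; exists del => // n s t h1 h2 h3.
  apply: le_lt_trans (H n s t h1 h2 h3); apply: ler_sum => i _.
  by have := coord_normr_le (w (t i) - w (s i)) j; rewrite !mxE.
have bvf j := absolutely_continuous_bounded_variation (acf j).
pose V t : R := \sum_j fine (total_variation 0 t (f j)).
have V0 : V 0 = 0.
  by rewrite /V big1// => j _; rewrite total_variationxx.
have wV s t : 0 <= s -> s <= t -> t <= 1 -> `|w t - w s| <= V t - V s.
  move=> s0 st t1; apply: (le_trans (normr_rV_le_sum _)).
  rewrite -sumrB; apply: ler_sum => j _; rewrite !mxE.
  have ts : bounded_variation 0 s (f j).
    by apply: bounded_variationl (bvf j) => //; exact: le_trans t1.
  have tt : bounded_variation 0 t (f j).
    by apply: bounded_variationl (bvf j) => //; exact: le_trans st.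
  have tst : bounded_variation s t (f j).
    by apply: bounded_variationr tt.
  move/bounded_variationP : ts => /(_ s0) ts.
  move/bounded_variationP : tst => /(_ st) tst.
  rewrite (total_variationD _ s0 st) fineD// addrAC subrr add0r.
  by rewrite -lee_fin fineK//; exact: total_variation_ge.
have Vnd s t : 0 <= s -> s <= t -> t <= 1 -> V s <= V t.
  by move=> s0 st t1; rewrite -subr_ge0; apply: le_trans (wV _ _ s0 st t1).
have Vc : {within `[0, 1], continuous V}.
  rewrite /V; elim: (index_enum 'I_d) => [|j r IH].
    rewrite (_ : (fun t => _) = cst 0); last by apply/funext => t; rewrite big_nil.
    exact: cst_continuous.
  rewrite (_ : (fun t => _) = (fun t => fine (total_variation 0 t (f j))) \+
      (fun t => \sum_(i <- r) fine (total_variation 0 t (f i)))); last first.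
    by apply/funext => t; rewrite big_cons.
  move=> x; apply: continuousD (IH x); move: x.
  apply: (@total_variation_continuous _ 0 1) => //.
  exact: absolutely_continuous_within.
have V1 : 0 <= V 1 by rewrite -V0; apply: Vnd.
(* A point where [V] reaches the fraction [s] of its total, by the intermediate value theorem. Any
   choice will do: [w] is constant wherever [V] is. *)
have tauP (s : R) : exists t, 0 <= s <= 1 -> 0 <= t <= 1 /\ V t = s * V 1.
  have [/andP[s0 s1]|] := boolP (0 <= s <= 1); last by exists 0.
  have [|t t01 Vt] := @IVT R V 0 1 (s * V 1) ler01 Vc.
    by rewrite V0 min_l// max_r// mulr_ge0//= ler_piMl.
  by exists t => _; split => //; move: t01; rewrite in_itv.
have [tau tauE] := choice tauP.
have wtau s t : 0 <= s <= 1 -> 0 <= t <= 1 -> `|w s - w t| <= `|V s - V t|.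
  wlog st : s t / s <= t.
    move=> W s01 t01; have [|/ltW] := leP s t; first by move=> ?; exact: W.
    by move=> ts; rewrite distrC (distrC (V s)); exact: W.
  move=> /andP[s0 s1] /andP[t0 t1]; rewrite distrC (distrC (V s)).
  by rewrite [leRHS]ger0_norm ?subr_ge0 ?Vnd//; exact: wV.
(* Adding 1 keeps the constant positive when the curve is constant. *)
exists tau, (V 1 + 1); split.
- by rewrite ltr_wpDl.
- by move=> s /tauE[].
- move=> s t s01 t01; have [ts Vs] := tauE s s01; have [tt Vt] := tauE t t01.
  apply: (le_trans (wtau _ _ ts tt)); rewrite Vs Vt -mulrBl normrM mulrC.
  by rewrite ler_wpM2r// ger0_norm// lerDl.
(* [tau 0] may differ from 0, but [V] agrees at both points, hence so does [w]. *)
- have [t0 Vt] := tauE 0 ltac:(by rewrite lexx ler01).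
  apply/eqP; rewrite -subr_eq0 -normr_le0.
  apply: (le_trans (wtau _ _ t0 _)); first by rewrite lexx ler01.
  by rewrite Vt V0 mul0r subrr normr0.
- have [t0 Vt] := tauE 1 ltac:(by rewrite lexx ler01).
  apply/eqP; rewrite -subr_eq0 -normr_le0.
  apply: (le_trans (wtau _ _ t0 _)); first by rewrite lexx ler01.
  by rewrite Vt mul1r subrr normr0.
Qed.

End absolutely_continuous_curves.

(** * Borel measures and their supports *)

Section integrals.
Local Open Scope ereal_scope.
Context d (T : measurableType d) {R : realType} (nu : {measure set T -> \bar R}).

(** [F - G] is a.e. nonnegative with nonpositive integral, so its absolute value integrates to 0. *)
Lemma ae_eq_of_integral_le (F G : T -> \bar R) :
  nu.-integrable setT F -> nu.-integrable setT G ->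
  {ae nu, forall x, G x <= F x} -> \int[nu]_x F x <= \int[nu]_x G x ->
  {ae nu, forall x, F x = G x}.
Proof.
move=> iF iG GF FG.
have fF := integrable_ae measurableT iF; have fG := integrable_ae measurableT iG.
have iH : nu.-integrable setT (F \- G) by exact: integrableB.
have mH := measurable_int nu iH.
have mA : measurable_fun setT (abse \o (F \- G)) by exact: measurableT_comp.
have H0 : \int[nu]_x `|(F \- G) x| = 0.
  apply/eqP; rewrite eq_le; apply/andP; split; last exact: integral_ge0.
  apply: (@le_trans _ _ (\int[nu]_x (F \- G) x)).
    rewrite le_eqVlt; apply/orP; left; apply/eqP.
    apply: ae_eq_integral => //.
    move: fF fG GF; apply: filterS3 => x /(_ I) fx /(_ I) gx gf _.
    by rewrite gee0_abs// sube_ge0// ?fx ?gx.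
  by rewrite integralB// sube_le0.
have := (ae_eq_integral_abs nu measurableT mH).1 H0.
move: fF fG; apply: filterS3 => x /(_ I) fx /(_ I) gx /(_ I)/= h.
by move: h; rewrite -(fineK fx) -(fineK gx) -EFinB => -[/subr0_eq ->].
Qed.

End integrals.

Section borel_measures.
Context {R : realType} {d : nat}.
Local Notation E := 'rV[R]_d.

(** Rational vectors, enumerated by their codes; 0 is the default at numbers that code nothing. *)
Lemma rV_dense_seq : exists D : nat -> E, forall x (e : R), 0 < e ->
  exists k, `|x - D k| < e.
Proof.
exists (fun k => if unpickle k is Some q then map_mx ratr (q : 'rV[rat]_d) else 0).
move=> x e e0.
have H j : exists q : rat, x ord0 j < ratr q < x ord0 j + e.
  have /rat_in_itvoo[q] : x ord0 j < x ord0 j + e by rewrite ltrDl.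
  by rewrite in_itv/= => ?; exists q.
have [q qP] := choice H.
exists (pickle (\row_j q j : 'rV[rat]_d)); rewrite pickleK.
rewrite [ltLHS]/Num.norm/= mx_normrE; apply/bigmax_ltP; split => //.
move=> [i j] _ /=; rewrite (ord1 i) !mxE distrC.
have /andP[q1 q2] := qP j; rewrite ger0_norm ?subr_ge0 ?ltW//.
by rewrite ltrBlDl.
Qed.

Lemma open_borel (U : set E) : open U -> measurable (U : set (borel E)).
Proof. exact: sub_sigma_algebra. Qed.

Lemma closed_borel (A : set E) : closed A -> measurable (A : set (borel E)).
Proof.
move=> cA; rewrite -(setCK A); apply: measurableC.
by apply: open_borel; exact: closed_openC.
Qed.

Lemma continuous_borel (f : E -> R) : continuous f ->
  measurable_fun [set: borel E] (f : borel E -> R).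
Proof.
move=> /continuousP cf; apply: (measurability _ (RGenOpens.measurableE R)).
move=> _ [_ [a [b ->]] <-]; rewrite setTI; apply: open_borel.
exact/cf/interval_open.
Qed.

Variable nu : probability (borel E) R.

Lemma spt_closed : closed (spt nu).
Proof.
have oP (A : set E) : (forall x, A x -> nbhs x A) -> open A by rewrite openE.
rewrite -openC; apply: oP => x /existsNP[U] /not_implyP[oU] /not_implyP[Ux nU].
apply: (@filterS _ _ _ U); last exact: open_nbhs_nbhs.
by move=> y Uy /(_ U oU Uy).
Qed.

(** A point outside the support lies in a null ball centred in the dense sequence with radius
    [1 / (n + 1)], and there are countably many such balls. *)
Lemma spt_full : {ae nu, forall x, spt nu x}.
Proof.
have [D Dd] := rV_dense_seq.
pose B (p : nat * nat) : set E := ball (D p.1) p.2.+1%:R^-1.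
pose F k : set (borel E) := if unpickle k is Some p then
  (if nu (B p) == 0%E then B p else set0) else set0.
apply: (@negligibleS _ _ _ nu (\bigcup_k F k)); last first.
  apply: negligible_bigcup => k; rewrite /F; case: (unpickle k) => [p|].
    case: eqP => [Bp|_]; last exact: negligible_set0.
    by apply/negligibleP => //; apply: open_borel; exact: ball_open.
  exact: negligible_set0.
move=> x /= /existsNP[U] /not_implyP[oU] /not_implyP[Ux nU].
have [e /= e0 eU] := (nbhs_ballP _ _).1 (open_nbhs_nbhs (conj oU Ux)).
have [n nP] : exists n, (n.+1%:R^-1 : R) < e / 2.
  exists (Num.truncn (e / 2)^-1).
  by rewrite invf_plt ?posrE ?divr_gt0//; exact: truncnS_gt.
have n0 : 0 < n.+1%:R^-1 :> R by rewrite invr_gt0.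
have [k kP] := Dd x _ n0.
have BU : B (k, n) `<=` U.
  move=> y; rewrite /B/= -ball_normE/= => Dy; apply: eU; rewrite -ball_normE/=.
  rewrite (splitr e) -(subrK (D k) x) -addrA (le_lt_trans (ler_normD _ _))//.
  by rewrite ltrD// (lt_trans _ nP).
have B0 : nu (B (k, n)) = 0%E.
  apply/eqP; rewrite eq_le measure_ge0 andbT.
  move/negP : nU; rewrite -leNgt; apply: le_trans; apply: le_measure.
  - by rewrite inE; apply: open_borel; exact: ball_open.
  - by rewrite inE; exact: open_borel.
  - exact: BU.
exists (pickle (k, n)) => //; rewrite /F pickleK B0 eqxx.
by rewrite /B/= -ball_normE/= distrC.
Qed.

Lemma spt_neq0 : spt nu !=set0.
Proof.
apply/set0P/eqP => s0; have := spt_full; rewrite s0.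
move=> /negligibleP; rewrite (_ : ~` _ = setT); last first.
  by apply/seteqP; split => // x _ [].
move=> /(_ measurableT) nu0; have := probability_setT nu.
by rewrite [LHS]nu0 => /esym/eqP; rewrite onee_eq0.
Qed.

(** The set where [f] and [g] differ is open and null, so it misses the support. *)
Lemma ae_eq_spt (f g : E -> R) : continuous f -> continuous g ->
  {ae nu, forall x, f x = g x} -> forall x, spt nu x -> f x = g x.
Proof.
move=> cf cg fg x sx; apply/eqP; rewrite -subr_eq0; apply/negPn/negP => nfg.
pose U : set E := [set y | f y - g y != 0].
have oU : open U.
  rewrite (_ : U = (fun y => f y - g y) @^-1` [set z | z != 0])//.
  apply: open_comp; last exact: open_neq.
  by move=> y _; apply: continuousB; [exact: cf|exact: cg].
have nU : nu.-negligible (U : set (borel E)).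
  by apply: negligibleS fg => y /= /eqP h e; apply: h; rewrite e subrr.
have := sx U oU nfg.
by rewrite ((negligibleP nu (open_borel oU)).1 nU) ltxx.
Qed.

End borel_measures.

(** * Almost-everywhere statements and integrability *)

Section general_measure.
Local Open Scope ereal_scope.
Context d (T : measurableType d) {R : realType}.

Lemma ae_eq_integrable (nu : {measure set T -> \bar R}) (F G : T -> \bar R) :
  nu.-integrable setT F -> measurable_fun setT G -> {ae nu, forall x, F x = G x} ->
  nu.-integrable setT G.
Proof.
move=> /integrableP[mF iF] mG FG; apply/integrableP; split => //.
have mF' : measurable_fun setT (abse \o F) by exact: measurableT_comp.
have mG' : measurable_fun setT (abse \o G) by exact: measurableT_comp.
suff <- : \int[nu]_x (abse \o F) x = \int[nu]_x (abse \o G) x by [].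
by apply: ae_eq_integral => //; apply: filterS FG => x /= ->.
Qed.

Lemma measurable_fun_patch (A : set T) (F : T -> \bar R) : measurable A ->
  measurable_fun setT F -> measurable_fun setT (patch (cst -oo) A F).
Proof.
move=> mA mF; rewrite -(setUv A); apply/measurable_funU => //.
  exact: measurableC.
split; [apply: (@eq_measurable_fun _ _ _ _ A F)|
  apply: (@eq_measurable_fun _ _ _ _ (~` A) (cst -oo))].
- by move=> x xA; rewrite /patch xA.
- exact: measurable_funTS.
- by move=> x; rewrite inE => /= xA; rewrite /patch memNset.
- exact: measurable_cst.
Qed.

(* Instances of [filterS] and [filterS2]: the filter structure of [{ae nu, _}]
   is not found by inference when [T] is [borel E]. *)
Lemma ae_imp (nu : probability T R) (P Q : T -> Prop) :
  (forall x, P x -> Q x) -> {ae nu, forall x, P x} -> {ae nu, forall x, Q x}.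
Proof. by move=> PQ; apply: filterS. Qed.

Lemma ae_imp2 (nu : probability T R) (P Q U : T -> Prop) :
  (forall x, P x -> Q x -> U x) ->
  {ae nu, forall x, P x} -> {ae nu, forall x, Q x} -> {ae nu, forall x, U x}.
Proof. by move=> PQU; apply: filterS2. Qed.

Lemma ae_ex (nu : probability T R) (P : T -> Prop) :
  {ae nu, forall x, P x} -> exists x, P x.
Proof.
move=> aeP; apply/not_existsP => nP.
have : nu.-negligible setT by apply: negligibleS aeP => x _; exact: nP.
move/(negligibleP nu measurableT) => nu0; have := probability_setT nu.
by rewrite [LHS]nu0 => /esym/eqP; rewrite onee_eq0.
Qed.

Lemma integrable_ex (nu : probability T R) (F : T -> \bar R) :
  nu.-integrable setT F -> exists x, F x \is a fin_num.
Proof.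
move=> /(integrable_ae measurableT) iF; apply: (@ae_ex nu).
by apply: filterS iF => x; apply.
Qed.

End general_measure.

(** * c-transforms *)

Section ctransforms.
Context {R : realType} {d : nat}.
Local Notation E := 'rV[R]_d.
Implicit Types (c : E * E -> R) (K : set E) (psi : E -> \bar R) (F : E -> R).

Lemma upper_semicontinuous_bounded K (f : E -> R) : compact K ->
  upper_semicontinuous f -> exists B, forall y, K y -> f y <= B.
Proof.
move=> /compact_near_coveringP cK uf.
have H : \forall B \near +oo, K `<=` (fun y => f y <= B).
  apply: (cK _ (+oo : set_system R) (fun B y => f y <= B)) => x Kx.
  exists ([set y | f y < f x + 1], [set B | f x + 1 <= B]) => /=.
    split; first by apply: uf; rewrite ltrDl.
    by apply: nbhs_pinfty_ge; exact: num_real.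
  by move=> [y B] /= [/ltW h1 h2]; exact: le_trans h2.
have [B BP] := filter_ex H.
by exists B.
Qed.

(** This modulus depends on [c] and [K] only, so all c-transforms inherit it at once. *)
Lemma equicontinuous_compact c K : continuous c -> compact K ->
  forall x (e : R), 0 < e ->
    \forall z \near x, forall y, K y -> `|c (z, y) - c (x, y)| <= e.
Proof.
move=> cc /compact_near_coveringP cK x e e0.
apply: (cK _ (nbhs x) (fun z y => `|c (z, y) - c (x, y)| <= e)) => y Ky.
have e2 : 0 < e / 2 by rewrite divr_gt0.
have /cvgrPdist_lt/(_ _ e2) [[U V] /= [Ux Vy] UV] := cc (x, y).
exists (V, U) => // -[y' z] /= [Vy' Uz].
have h1 := UV (z, y') (conj Uz Vy').
have h2 := UV (x, y') (conj (nbhs_singleton Ux) Vy').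
rewrite -(subrK (c (x, y)) (c (z, y'))) -addrA.
rewrite (le_trans (ler_normD _ _))// (splitr e) lerD//; last exact: ltW.
by rewrite distrC ltW.
Qed.

(* [F] is the c-transform of [psi] computed on [K]; stated through its
   characteristic property, so that [psi] may take the value -oo. *)
Definition is_ctransform c K psi F :=
  (forall x y, K y -> ((F x)%:E + psi y <= (c (x, y))%:E)%E) /\
  (forall x (e : R), 0 < e -> exists y, [/\ K y, psi y \is a fin_num &
     c (x, y) - fine (psi y) <= F x + e]).

Lemma is_ctransform_le c K psi F y x : is_ctransform c K psi F ->
  K y -> psi y \is a fin_num -> F x <= c (x, y) - fine (psi y).
Proof.
move=> [FK _] Ky yf; have := FK x y Ky.
by rewrite -(fineK yf) -EFinD lee_fin /= lerBrDr.
Qed.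

(** A near-minimiser for [x'] is tested at [x]. *)
Lemma is_ctransform_sub_le c K psi F x x' (r : R) : is_ctransform c K psi F ->
  (forall y, K y -> c (x, y) - c (x', y) <= r) -> F x - F x' <= r.
Proof.
move=> cF cr; apply/ler_addgt0Pr => e e0.
have [y [Ky yf yP]] := cF.2 x' e e0.
have := is_ctransform_le x cF Ky yf; have := cr y Ky; lra.
Qed.

Lemma is_ctransform_dist c K psi F x x' (r : R) : is_ctransform c K psi F ->
  (forall y, K y -> `|c (x, y) - c (x', y)| <= r) -> `|F x - F x'| <= r.
Proof.
move=> cF cr; apply/ler_normlP; rewrite opprB; split;
  apply: (is_ctransform_sub_le cF) => y /cr /ler_normlP[]//.
by rewrite opprB.
Qed.

Lemma is_ctransform_continuous c K psi F : continuous c -> compact K ->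
  is_ctransform c K psi F -> continuous F.
Proof.
move=> cc cK cF x; apply/(@cvgrPdist_le _ _ _ (nbhs x)) => e e0.
have := equicontinuous_compact cc cK x e0; apply: filterS => z H.
by rewrite distrC; exact: (is_ctransform_dist cF).
Qed.

Lemma is_ctransform_addr c K psi F (l : R) : is_ctransform c K psi F ->
  is_ctransform c K (fun y => psi y + l%:E)%E (fun x => F x - l).
Proof.
move=> [F1 F2]; split=> [x y Ky|x e e0].
  have := F1 x y Ky; case: (psi y) => [s| |]//=.
    by rewrite -!EFinD !lee_fin; lra.
have [y [Ky yf yP]] := F2 x e e0; exists y; split => //.
  by rewrite fin_numD yf.
by rewrite fineD//=; lra.
Qed.

End ctransforms.

(** * Admissible pairs, their c-transforms and optimality *)

Section dual_pairs.
Context {R : realType} {d : nat}.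
Local Notation E := 'rV[R]_d.
Variables (c : E * E -> R) (a b : E -> R) (rho mu : probability (borel E) R).
Let S := spt rho.
Let K := spt mu.
Hypotheses (c_cont : continuous c) (cK : compact K)
  (b_usc : upper_semicontinuous b)
  (a_L1 : rho.-integrable [set: E] (EFin \o a))
  (c_le : forall x y, `|c (x, y)| <= a x + b y).

(** The infimum is taken over the points of [K] where [psi] is finite. There are some because [mu]
    is carried by [K] and [psi] is integrable. *)
Lemma ctransform_exists phi psi : dual_admissible c rho mu phi psi ->
  exists F, is_ctransform c K psi F /\ forall x, (phi x <= (F x)%:E)%E.
Proof.
move=> [[iphi phiy] [ipsi psiy] pp].
have [B BP] := upper_semicontinuous_bounded cK b_usc.
have [x1 x1f] := integrable_ex iphi.
have [y0 [Ky0 y0f]] : exists y, K y /\ psi y \is a fin_num.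
  apply: (@ae_ex _ _ _ mu); apply: ae_imp2 (spt_full mu) (integrable_ae measurableT ipsi).
  by move=> y sy /(_ I).
pose A x := [set c (x, y) - fine (psi y) | y in
  [set y | K y /\ psi y \is a fin_num]].
have A0 x : A x !=set0 by exists (c (x, y0) - fine (psi y0)), y0.
have lbA x r : (forall y, K y -> psi y \is a fin_num ->
    r <= c (x, y) - fine (psi y)) -> lbound (A x) r.
  by move=> H _ [y [Ky yf] <-]; exact: H.
have phile x y : K y -> phi x \is a fin_num -> psi y \is a fin_num ->
    fine (phi x) <= c (x, y) - fine (psi y).
  move=> Ky xf yf; have := pp x y.
  by rewrite -(fineK xf) -(fineK yf) -EFinD lee_fin /= lerBrDr.
have hA x : has_inf (A x).
  (* Admissibility at a point [x1] where [phi] is finite bounds [c (x1, y) - psi y] below, and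
     [c (x, y) - c (x1, y)] is bounded for [y] in [K]. *)
  split => //; exists (- (a x + B) - (a x1 + B) + fine (phi x1)).
  apply: lbA => y Ky yf.
  have := phile x1 y Ky x1f yf; have := BP y Ky.
  have /ler_normlP[] := c_le x y; have /ler_normlP[] := c_le x1 y; lra.
exists (fun x => inf (A x)); split; first split.
- move=> x y Ky; have [yf|] := boolP (psi y \is a fin_num).
    rewrite -(fineK yf) -EFinD lee_fin -lerBrDr.
    by apply: ge_inf; [exact: (hA x).2|exists y].
  by rewrite fin_numE negb_and !negbK => /orP[] /eqP E; [rewrite E addeNy leNye|
    have := psiy y; rewrite E].
- move=> x e e0; have [_ [y [Ky yf] <-] ye] := inf_adherent e0 (hA x).
  by exists y; split => //; exact: ltW.
- move=> x; have [xf|] := boolP (phi x \is a fin_num).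
    rewrite -(fineK xf) lee_fin; apply: lb_le_inf => //.
    by apply: lbA => y Ky yf; exact: phile.
  by rewrite fin_numE negb_and !negbK => /orP[] /eqP E; [rewrite E leNye|
    have := phiy x; rewrite E].
Qed.

(** The right-hand side is independent of [psi]; with [x' = 0] it dominates all normalised
    c-transforms simultaneously. *)
Lemma is_ctransform_bound B psi F x x' : is_ctransform c K psi F ->
  (forall y, K y -> b y <= B) -> `|F x - F x'| <= a x + a x' + 2 * B.
Proof.
move=> cF BP; apply: (is_ctransform_dist cF) => y /BP yB.
have := c_le x y; have := c_le x' y; rewrite !ler_norml.
by move=> /andP[h1 h2] /andP[h3 h4]; apply/andP; split; lra.
Qed.

Lemma integrable_addr_cst (nu : probability (borel E) R) (f : E -> R) (l : R) :
  nu.-integrable [set: E] (EFin \o f) ->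
  nu.-integrable [set: E] (EFin \o (fun x => f x + l)).
Proof.
move=> fi; rewrite (_ : _ \o _ = (EFin \o f) \+ cst l%:E)%E; last exact/funext.
by apply: integrableD => //; exact: finite_measure_integrable_cst.
Qed.

Lemma is_ctransform_integrable psi F : is_ctransform c K psi F ->
  rho.-integrable [set: E] (EFin \o F).
Proof.
move=> cF; have [B BP] := upper_semicontinuous_bounded cK b_usc.
have Fm : measurable_fun [set: borel E] (EFin \o F).
  apply/measurable_EFinP; apply: continuous_borel.
  exact: is_ctransform_continuous cF.
apply: (@le_integrable _ _ _ rho _ _ _
    (EFin \o (fun x => a x + (a 0 + 2 * B + `|F 0|)))) => //; last first.
  exact: integrable_addr_cst.
move=> x _ /=; rewrite lee_fin; apply: le_trans (ler_norm _).
have := is_ctransform_bound x 0 cF BP.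
rewrite ler_distl => /andP[h1 h2].
have := ler_norm (F 0); have := ler_norm (- F 0); rewrite normrN.
by move=> h3 h4; apply/ler_normlP; split; lra.
Qed.

(** The constraint is imposed on the whole space, while the competitors built here satisfy it only
    on the supports. Setting both functions to -oo elsewhere restores it and keeps the integrals. *)
Lemma dual_admissible_patch (F G : E -> \bar R) :
  rho.-integrable [set: E] F -> mu.-integrable [set: E] G ->
  (forall x, S x -> F x < +oo)%E -> (forall y, K y -> G y < +oo)%E ->
  (forall x y, S x -> K y -> F x + G y <= (c (x, y))%:E)%E ->
  exists phi psi, dual_admissible c rho mu phi psi /\
    dual_value rho mu phi psi = dual_value rho mu F G.
Proof.
move=> iF iG Fy Gy FG.
have P (nu : probability (borel E) R) (H : E -> \bar R) :
    nu.-integrable [set: E] H ->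
    nu.-integrable [set: E] (patch (cst -oo%E) (spt nu) H) /\
    (\int[nu]_x patch (cst -oo%E) (spt nu) H x = \int[nu]_x H x)%E.
  move=> iH; have mH := measurable_int nu iH.
  have mP : measurable_fun [set: borel E] (patch (cst -oo%E) (spt nu) H).
    apply: (@measurable_fun_patch _ (borel E)) => //.
    exact: (@closed_borel R d _ (@spt_closed R d nu)).
  have HP : {ae nu, forall x, H x = patch (cst -oo%E) (spt nu) H x}.
    by apply: ae_imp (spt_full nu) => x sx; rewrite /patch mem_set.
  split; first exact: ae_eq_integrable HP.
  by apply: ae_eq_integral => //; apply: ae_imp HP => x ->.
exists (patch (cst -oo%E) S F), (patch (cst -oo%E) K G); split; last first.
  by rewrite /dual_value (P _ _ iF).2 (P _ _ iG).2.
split; [split|split|].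
- exact: (P _ _ iF).1.
- by move=> x; rewrite /patch; case: ifPn => [/set_mem/Fy|_]//; exact: ltNyr.
- exact: (P _ _ iG).1.
- by move=> x; rewrite /patch; case: ifPn => [/set_mem/Gy|_]//; exact: ltNyr.
- move=> x y; rewrite /patch; case: ifPn => [/set_mem Sx|_].
    case: ifPn => [/set_mem Ky|_]; first exact: FG.
    by rewrite addeNy leNye.
  by rewrite addNye leNye.
Qed.

Lemma dual_optimiser_ge phi psi (F G : E -> \bar R) :
  dual_optimiser c rho mu phi psi ->
  rho.-integrable [set: E] F -> mu.-integrable [set: E] G ->
  (forall x, S x -> F x < +oo)%E -> (forall y, K y -> G y < +oo)%E ->
  (forall x y, S x -> K y -> F x + G y <= (c (x, y))%:E)%E ->
  (dual_value rho mu F G <= dual_value rho mu phi psi)%E.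
Proof.
move=> [_ opt] iF iG Fy Gy FG.
have [phi' [psi' [adm <-]]] := dual_admissible_patch iF iG Fy Gy FG.
exact: opt.
Qed.

(** [(F, psi)] competes with [(phi, psi)] and [F] dominates [phi], so optimality forces their
    integrals to agree. *)
Lemma dual_optimiser_ctransform phi psi F : dual_optimiser c rho mu phi psi ->
  is_ctransform c K psi F -> (forall x, phi x <= (F x)%:E)%E ->
  {ae rho, forall x, phi x = (F x)%:E}.
Proof.
move=> opt cF phiF; have [[iphi phiy] [ipsi psiy] pp] := opt.1.
have iF := is_ctransform_integrable cF.
have : (dual_value rho mu (EFin \o F) psi <= dual_value rho mu phi psi)%E.
  apply: dual_optimiser_ge => //; first by move=> x _; exact: ltry.
  by move=> x y _; exact: cF.1.
rewrite /dual_value leeD2rE ?(integrable_fin_num _ ipsi)// => H.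
have aphi : {ae rho, forall x, (phi x <= (EFin \o F) x)%E} by apply: aeW.
have := ae_eq_of_integral_le iF iphi aphi H.
by apply: ae_imp => x /= ->.
Qed.

End dual_pairs.

(** * Existence *)

Section limits.
Context {R : realType}.
Local Open Scope ereal_scope.
Implicit Types (x t : (\bar R)^nat).

Lemma limn_esup_le_of_cvg x t l :
  (forall n, x n <= t n) -> t @ \oo --> l -> limn_esup x <= l.
Proof.
move=> xt tl; rewrite -(cvg_limn_einf_sup tl).2 !limn_esup_lim.
apply: lee_lim; [exact: is_cvg_esups|exact: is_cvg_esups|].
apply: nearW => n; apply: ge_ereal_sup => _ [m nm <-].
by apply: le_trans (xt m) _; apply: ereal_sup_ubound; exists m.
Qed.

Lemma limn_einf_le_of_cvg x t l :
  (forall n, x n <= t n) -> t @ \oo --> l -> limn_einf x <= l.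
Proof.
move=> xt tl; apply: le_trans (limn_einf_sup x) _.
exact: limn_esup_le_of_cvg tl.
Qed.

Lemma einf_subl (l : R) x : limn_einf (fun n => l%:E - x n) = l%:E - limn_esup x.
Proof.
rewrite -limn_einfN -limn_einf_shift//.
Qed.

End limits.

(** * Extraction of pointwise convergent sequences *)

Section extraction.
Context {R : realType}.

(* [sigma] need not be increasing: [N <= sigma N] suffices below. *)
Lemma bounded_extraction (f : nat -> nat -> R) (M : nat -> R) :
  (forall n k, `|f n k| <= M k) ->
  exists (sigma : nat -> nat) (g : nat -> R), forall N, (N <= sigma N)%N /\
    forall k, (k <= N)%N -> `|g k - f (sigma N) k| < N.+1%:R^-1.
Proof.
(* By Tychonoff's theorem the sequence has a cluster point [g] in a product of segments; [sigma N]
   is an index at least [N] whose first [N + 1] coordinates are close to those of [g]. *)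
move=> fM; pose T : topologicalType := prod_topology (fun _ : nat => (R : topologicalType)).
pose box : set T := [set h | forall k, `[- M k, M k]%classic (h k)].
pose F (n : nat) : T := f n.
have cbox : compact box.
  by apply: (@tychonoff nat (fun=> R) (fun k => `[- M k, M k]%classic)) => k; exact: segment_compact.
have /cbox : (F @ \oo) box.
  by exists 0%N => // n _ k /=; rewrite in_itv/= -ler_norml.
move=> [g [_ cg]].
have H N : exists n, (N <= n)%N /\ forall k, (k <= N)%N -> `|g k - f n k| < N.+1%:R^-1.
  pose B : set T := [set h | forall k : 'I_N.+1, `|g k - h k| < N.+1%:R^-1].
  have gB : nbhs g B.
    apply: (@filter_forall T 'I_N.+1 (fun k h => `|g k - h k| < N.+1%:R^-1) (nbhs g)) => k.
    have e0 : (0 : R) < N.+1%:R^-1 by rewrite invr_gt0.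
    have := @proj_continuous nat (fun=> R) k g _ (nbhsx_ballx (g k) _ e0).
    by rewrite -ball_normE.
  have fN : (F @ \oo) [set h | exists2 n, (N <= n)%N & h = F n].
    by exists N => // n /= Nn; exists n.
  have [h [[n Nn ->] Bn]] := cg _ _ fN gB.
  exists n; split => // k kN.
  by have := Bn (Ordinal (kN : (k < N.+1)%N)).
have [sigma sP] := choice H.
by exists sigma, g.
Qed.

(** Arzela-Ascoli in pointwise form: the values at the dense points converge, and equicontinuity
    makes the values at every other point Cauchy. *)
Lemma equicontinuous_extraction {d : nat} (u : nat -> 'rV[R]_d -> R)
    (M : 'rV[R]_d -> R) :
  (forall n x, `|u n x| <= M x) ->
  (forall x (e : R), 0 < e -> \forall z \near x, forall n, `|u n z - u n x| <= e) ->
  exists (sigma : nat -> nat) (U : 'rV[R]_d -> R), (forall N, (N <= sigma N)%N) /\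
    forall x, u (sigma N) x @[N --> \oo] --> U x.
Proof.
move=> uM equ; have [D Dd] := @rV_dense_seq R d.
have [sigma [g sg]] := @bounded_extraction (fun n k => u n (D k)) (M \o D) (fun n k => uM n (D k)).
exists sigma, (fun x => lim (u (sigma N) x @[N --> \oo])); split.
  by move=> N; exact: (sg N).1.
move=> x; apply/cauchy_cvgP/cauchy_exP => e e0.
have e3 : 0 < e / 3 by rewrite divr_gt0.
have /nbhs_ballP[r /= r0 rP] := equ x _ e3.
have [k kP] := Dd x r r0.
have {}kP n : `|u n (D k) - u n x| <= e / 3.
  by apply: rP; rewrite -ball_normE.
exists (g k).
have small : \forall N \near \oo, N.+1%:R^-1 < e / 3.
  have := @cvg_harmonic R; move=> /cvgr0Pnorm_lt/(_ _ e3); apply: filterS => N.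
  by rewrite ger0_norm ?invr_ge0.
near=> N.
have Ne : N.+1%:R^-1 < e / 3 by near: N.
have kN : (k <= N)%N by near: N; exact: nbhs_infty_ge.
have := (sg N).2 k kN; have := kP (sigma N); move: Ne; set q := N.+1%:R^-1 => Ne.
rewrite -ball_normE /= => /ler_normlP[h1 h2] /ltr_normlP[h3 h4].
by apply/ltr_normlP; split; lra.
Unshelve. all: by end_near. Qed.

End extraction.

Section existence.
Context {R : realType} {d : nat}.
Local Notation E := 'rV[R]_d.
Variables (c : E * E -> R) (a b : E -> R) (rho mu : probability (borel E) R).
Let S := spt rho.
Let K := spt mu.
Hypotheses (c_cont : continuous c) (cK : compact K)
  (b_usc : upper_semicontinuous b)
  (a_L1 : rho.-integrable [set: E] (EFin \o a))
  (b_L1 : mu.-integrable [set: E] (EFin \o b))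
  (c_le : forall x y, `|c (x, y)| <= a x + b y).

(* Replaces [phi] by the c-transform of [psi], restricts [psi] to [K], and
   shifts by the constant that makes the first potential vanish at 0. *)
Lemma normalised_pair phi psi : dual_admissible c rho mu phi psi ->
  exists (u : E -> R) (v : E -> \bar R), [/\ is_ctransform c K v u, u 0 = 0,
    mu.-integrable [set: E] v, forall y, (v y <= (a 0 + b y)%:E)%E &
    (dual_value rho mu phi psi <= dual_value rho mu (EFin \o u) v)%E].
Proof.
move=> adm; have [[iphi _] [ipsi psiy] _] := adm.
have [F [cF phiF]] := ctransform_exists cK b_usc c_le adm.
pose w y := (psi y + (F 0)%:E)%E.
(* The value -oo off [K] makes the bound by [a 0 + b] global; on [K] it comes from the constraint at
   [x = 0], where the first potential vanishes. *)
pose v := patch (cst -oo%E) K w.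
have icst (nu : probability (borel E) R) (l : R) :
    nu.-integrable [set: E] (cst l%:E) by exact: finite_measure_integrable_cst.
have iw : mu.-integrable [set: E] w.
  exact: (integrableD measurableT ipsi (icst mu (F 0))).
have mw := measurable_int mu iw.
have mv : measurable_fun [set: borel E] v.
  apply: (@measurable_fun_patch _ (borel E)) => //.
  exact: (@closed_borel R d _ (@spt_closed R d mu)).
have vw : {ae mu, forall y, w y = v y}.
  by apply: ae_imp (spt_full mu) => y sy; rewrite /v /patch; case: ifPn => // /negP[]; exact: mem_set.
have iv : mu.-integrable [set: E] v by exact: ae_eq_integrable vw.
have cw := is_ctransform_addr (F 0) cF.
have vK y : K y -> v y = w y.
  by move=> Ky; rewrite /v /patch; case: ifPn => // /negP[]; exact: mem_set.
exists (fun x => F x - F 0), v; split => //.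
- split=> [x y Ky|x e e0]; first by rewrite vK//; exact: cw.1.
  have [y [Ky yf yP]] := cw.2 x e e0; exists y; split => //; rewrite vK//.
- by rewrite subrr.
- move=> y; have [Ky|nKy] := pselect (K y); last first.
    by rewrite /v /patch; case: ifPn => [/set_mem//|_]; exact: leNye.
  rewrite vK//; have := cw.1 0 y Ky; rewrite subrr add0e => /le_trans; apply.
  by rewrite lee_fin; apply: le_trans (ler_norm _) _; exact: c_le.
- have iF := is_ctransform_integrable c_cont cK b_usc a_L1 c_le cF.
  have -> : dual_value rho mu (EFin \o (fun x => F x - F 0)) v =
      dual_value rho mu (EFin \o F) psi.
    rewrite /dual_value.
    have -> : (\int[mu]_y v y = \int[mu]_y w y)%E.
      by apply: ae_eq_integral => //; apply: ae_imp vw => y ->.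
    rewrite (_ : EFin \o _ = (EFin \o F) \- cst (F 0)%:E)%E; last exact/funext.
    have cstE (nu : probability (borel E) R) :
        (\int[nu]_x cst (F 0)%:E x = (F 0)%:E)%E.
      by rewrite integral_cst// [X in (_ * X)%E](probability_setT nu) mule1.
    rewrite (integralB measurableT iF (icst rho (F 0))) cstE.
    rewrite (integralD measurableT ipsi (icst mu (F 0))) cstE.
    rewrite -(fineK (integrable_fin_num measurableT iF)).
    rewrite -(fineK (integrable_fin_num measurableT ipsi)).
    by rewrite -!EFinD; congr EFin; lra.
  by apply: leeD2r; apply: le_integral => // x _; exact: phiF.
Qed.

Lemma dual_optimiser_exists : exists phi psi, dual_optimiser c rho mu phi psi.
Proof.
have [B BP] := upper_semicontinuous_bounded cK b_usc.
(* [g] dominates the absolute values of all normalised first potentials, and [w] bounds all second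
   ones above: the former serves dominated convergence, the latter Fatou's lemma. *)
pose g x := a x + (a 0 + 2 * B).
have ig : rho.-integrable [set: E] (EFin \o g) by exact: integrable_addr_cst.
pose w y := b y + a 0.
have iw : mu.-integrable [set: E] (EFin \o w) by exact: integrable_addr_cst.
have mw := measurable_int mu iw.
have ug (u : E -> R) v : is_ctransform c K v u -> u 0 = 0 -> forall x, `|u x| <= g x.
  move=> cu u0 x; have := is_ctransform_bound c_le x 0 cu BP.
  by rewrite u0 subr0 /g addrA.
pose vals := [set r | exists phi psi, dual_admissible c rho mu phi psi /\
  r = fine (dual_value rho mu phi psi)].
have dual_fin F G : rho.-integrable [set: E] F -> mu.-integrable [set: E] G ->
    dual_value rho mu F G \is a fin_num.
  by move=> iF iG; rewrite fin_numD !integrable_fin_num.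
have adm_fin phi psi : dual_admissible c rho mu phi psi ->
    dual_value rho mu phi psi \is a fin_num.
  by move=> [[iphi _] [ipsi _] _]; exact: dual_fin.
(* The pair [(-a, -b)] is admissible, and [g] and [w] bound every value above. *)
have vals_sup : has_sup vals.
  split.
    pose phi x := (- (EFin \o a) x)%E; pose psi y := (- (EFin \o b) y)%E.
    exists (fine (dual_value rho mu phi psi)), phi, psi; split => //.
    split; [split|split|].
    - exact: integrableN.
    - by move=> x; rewrite /phi /= ltry.
    - exact: integrableN.
    - by move=> x; rewrite /psi /= ltry.
    - move=> x y; rewrite /phi /psi /= -EFinD lee_fin.
      by have := c_le x y; rewrite ler_norml => /andP[]; lra.
  exists (fine (dual_value rho mu (EFin \o g) (EFin \o w))).
  move=> _ [phi [psi [adm ->]]]; apply: fine_le; [exact: adm_fin|exact: dual_fin|].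
  have [u [v [cu u0 iv vw le_uv]]] := normalised_pair adm.
  have iu := is_ctransform_integrable c_cont cK b_usc a_L1 c_le cu.
  apply: (le_trans le_uv); apply: leeD; apply: le_integral => // x _.
    by rewrite /= lee_fin; apply: le_trans (ler_norm _) _; exact: (ug _ _ cu u0).
  by rewrite /= /w addrC.
pose V := sup vals.
pose good n (p : (E -> R) * (E -> \bar R)) :=
  [/\ is_ctransform c K p.2 p.1, p.1 0 = 0, mu.-integrable [set: E] p.2,
    forall y, (p.2 y <= (w y)%:E)%E &
    ((V - n.+1%:R^-1)%:E <= dual_value rho mu (EFin \o p.1) p.2)%E].
have /choice[uv uvP] : forall n, exists p, good n p.
  move=> n; have n0 : (0 : R) < n.+1%:R^-1 by rewrite invr_gt0.
  have [_ [phi [psi [adm ->]]] Vr] := sup_adherent n0 vals_sup.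
  have [u [v [cu u0 iv vw le_uv]]] := normalised_pair adm.
  exists (u, v); split => //; first by move=> y; rewrite /w addrC.
  apply: le_trans le_uv; rewrite -(fineK (adm_fin _ _ adm)) lee_fin.
  exact: ltW.
pose u n := (uv n).1; pose v n := (uv n).2.
have vP n : [/\ is_ctransform c K (v n) (u n), u n 0 = 0,
    mu.-integrable [set: E] (v n), forall y, (v n y <= (w y)%:E)%E &
    ((V - n.+1%:R^-1)%:E <= dual_value rho mu (EFin \o u n) (v n))%E] := uvP n.
have uM n x : `|u n x| <= g x by have [cu u0 _ _ _] := vP n; exact: (ug _ _ cu u0).
have equ x (e : R) : 0 < e -> \forall z \near x, forall n, `|u n z - u n x| <= e.
  move=> e0; have := equicontinuous_compact c_cont cK x e0.
  apply: filterS => z zP n; have [cu _ _ _ _] := vP n.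
  exact: (is_ctransform_dist cu zP).
have [sigma [U [sge cvU]]] := equicontinuous_extraction uM equ.
have iu n : rho.-integrable [set: E] (EFin \o u (sigma n)).
  have [cu _ _ _ _] := vP (sigma n).
  exact: (is_ctransform_integrable c_cont cK b_usc a_L1 c_le cu).
have iv n : mu.-integrable [set: E] (v (sigma n)) by have [] := vP (sigma n).
have vw n y : (v (sigma n) y <= (w y)%:E)%E by have [] := vP (sigma n).
have cvUE x : (u (sigma n) x)%:E @[n --> \oo] --> (U x)%:E.
  by apply/fine_cvgP; split; [exact: nearW|exact: cvU].
have mu_ n := measurable_int rho (iu n).
have mU : measurable_fun [set: borel E] (EFin \o U).
  by apply: (@emeasurable_fun_cvg _ (borel E) R setT (fun n => EFin \o u (sigma n))
    (EFin \o U) mu_) => x _; exact: cvUE.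
pose un n (x : borel E) := (u (sigma n) x)%:E.
have ae_cvU : {ae rho, forall x, setT x -> un ^~ x @ \oo --> (EFin \o U) x}.
  by apply: aeW => x _; exact: cvUE.
have ae_ug : {ae rho, forall x n, setT x -> (`|un n x| <= (EFin \o g) x)%E}.
  by apply: aeW => x n _; rewrite lee_fin; exact: uM.
have [iU _ cvIu] := @dominated_convergence _ (borel E) R rho _ measurableT
  un (EFin \o U) (EFin \o g) mu_ mU ae_cvU ig ae_ug.
pose W y := limn_esup (fun n => v (sigma n) y).
have mv n := measurable_int mu (iv n).
have mW : measurable_fun [set: borel E] W by exact: measurable_fun_limn_esup.
have Ww y : (W y <= (w y)%:E)%E.
  by apply: (limn_esup_le_of_cvg (fun n => vw n y)); exact: cvg_cst.
have UW x y : K y -> ((U x)%:E + W y <= (c (x, y))%:E)%E.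
  move=> Ky; rewrite -leeBrDl//.
  apply: (@limn_esup_le_of_cvg _ _ (fun n => (c (x, y))%:E - (u (sigma n) x)%:E)%E).
    move=> n; have [cu _ _ _ _] := vP (sigma n).
    by rewrite leeBrDl//; exact: cu.1.
  by apply: cvgeB => //; exact: cvg_cst.
pose Iw := fine (\int[mu]_y (w y)%:E).
have IwE : (\int[mu]_y (w y)%:E = Iw%:E)%E by rewrite fineK//; exact: integrable_fin_num.
pose IU := fine (\int[rho]_x (U x)%:E).
have IUE : (\int[rho]_x (U x)%:E = IU%:E)%E by rewrite fineK//; exact: integrable_fin_num.
(* Fatou's lemma is applied to the gaps [w - v (sigma n)], whose limit inferior is [w - W]. *)
have gap_ge0 n y : (0 <= (w y)%:E - v (sigma n) y)%E.
  have := vw n y; case: (v (sigma n) y) => [r| |].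
  - by rewrite -EFinB !lee_fin subr_ge0.
  - by rewrite leye_eq.
  - by rewrite /= addey// leey.
have mgap n : measurable_fun [set: borel E] (fun y => (w y)%:E - v (sigma n) y)%E.
  by apply: emeasurable_funB.
have := @fatou _ (borel E) R mu _ measurableT _ mgap (fun n y _ => gap_ge0 n y).
under eq_integral do rewrite einf_subl.
rewrite -/W => fat.
(* Near-optimality of the pairs, rewritten as an upper bound on the integral of the gap. *)
pose t n := (Iw - (V - (sigma n).+1%:R^-1) + fine (\int[rho]_x (u (sigma n) x)%:E))%:E.
have gap_le n : (\int[mu]_y ((w y)%:E - v (sigma n) y) <= t n)%E.
  rewrite (integralB measurableT iw (iv n)) IwE.
  have [_ _ _ _] := vP (sigma n); rewrite /dual_value.
  rewrite -(fineK (integrable_fin_num measurableT (iu n))).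
  rewrite -(fineK (integrable_fin_num measurableT (iv n))).
  by rewrite -!EFinD !lee_fin /= /t; set q := _^-1; lra.
have cvt : t n @[n --> \oo] --> (Iw - V + IU)%:E.
  apply/fine_cvgP; split; first exact: nearW.
  have cvIu' : fine (\int[rho]_x (u (sigma n) x)%:E) @[n --> \oo] --> IU.
    by apply: fine_cvg; rewrite -IUE; exact: cvIu.
  (* Here [N <= sigma N] is what makes the error vanish. *)
  have cvq : (sigma n).+1%:R^-1 @[n --> \oo] --> (0 : R).
    apply/cvgr0Pnorm_lt => e e0.
    have := @cvg_harmonic R; move=> /cvgr0Pnorm_lt/(_ _ e0); apply: filterS => n.
    rewrite !ger0_norm ?invr_ge0//; apply: le_lt_trans.
    by rewrite lef_pV2 ?posrE// ler_nat ltnS.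
  rewrite (_ : Iw - V + IU = Iw - (V - 0) + IU); last by rewrite subr0.
  apply: cvgD => //; apply: cvgB; first exact: cvg_cst.
  by apply: cvgB => //; exact: cvg_cst.
have gapW : (\int[mu]_y ((w y)%:E - W y) <= (Iw - V + IU)%:E)%E.
  by apply: le_trans fat _; apply: limn_einf_le_of_cvg cvt.
have gapW_ge0 y : (0 <= (w y)%:E - W y)%E.
  have := Ww y; case: (W y) => [r| |].
  - by rewrite -EFinB !lee_fin subr_ge0.
  - by rewrite leye_eq.
  - by rewrite /= addey// leey.
have mgapW : measurable_fun [set: borel E] (fun y => (w y)%:E - W y)%E.
  by apply: emeasurable_funB.
have igapW : mu.-integrable [set: E] (fun y => (w y)%:E - W y)%E.
  apply/integrableP; split => //.
  under eq_integral do rewrite gee0_abs//.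
  exact: le_lt_trans gapW (ltry _).
(* Valid also where [W] is -oo, since [w] is finite; integrability of the gap thus passes to [W]. *)
have WE : W = (fun y => (w y)%:E - ((w y)%:E - W y))%E.
  apply/funext => y; have := Ww y; case: (W y) => [r _| |//].
    by rewrite -!EFinB opprB addrC subrK.
  by rewrite leye_eq.
have iW : mu.-integrable [set: E] W.
  by rewrite WE; apply: integrableB.
have valUW : (V%:E <= dual_value rho mu (EFin \o U) W)%E.
  have : (\int[mu]_y W y = Iw%:E - \int[mu]_y ((w y)%:E - W y))%E.
    by rewrite {1}WE -IwE (integralB measurableT iw igapW).
  rewrite /dual_value => ->; rewrite [X in (X + _)%E]IUE; move: gapW.
  rewrite -(fineK (integrable_fin_num measurableT igapW)).
  by rewrite -!EFinD !lee_fin; lra.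
have [phi [psi [adm value]]] := @dual_admissible_patch _ _ c rho mu _ _ iU iW
  (fun x _ => ltry _) (fun y _ => le_lt_trans (Ww y) (ltry _)) (fun x y _ Ky => UW x y Ky).
exists phi, psi; split => // phi' psi' adm'.
rewrite value; apply: le_trans valUW.
rewrite -(fineK (adm_fin _ _ adm')) lee_fin; apply: ub_le_sup.
  exact: vals_sup.2.
by exists phi', psi'.
Qed.

End existence.
(** * Uniqueness *)

Lemma continuous_lincomb {R : realType} {T : topologicalType} (k l : R)
    (f g : T -> R) :
  continuous f -> continuous g -> continuous (fun x => k * f x + l * g x).
Proof. by move=> cf cg x; apply: cvgD; apply: cvgMl_tmp; [exact: cf|exact: cg]. Qed.

Lemma continuous_pairr {T U V : topologicalType} (f : T * U -> V) (x : T) :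
  continuous f -> continuous (fun y => f (x, y)).
Proof.
move=> cf y; apply: (@continuous_comp _ _ _ (fun y => (x, y)) f); last exact: cf.
by apply: cvg_pair; [exact: cvg_cst|exact: cvg_id].
Qed.

Section uniqueness.
Context {R : realType} {d : nat}.
Local Notation E := 'rV[R]_d.
Variables (c : E * E -> R) (a b : E -> R) (rho mu : probability (borel E) R).
Let S := spt rho.
Let K := spt mu.
Hypotheses (rho_conn : rectifiably_connected S) (cK : compact K) (c_C1 : C1 c)
  (b_usc : upper_semicontinuous b)
  (a_L1 : rho.-integrable [set: E] (EFin \o a))
  (c_le : forall x y, `|c (x, y)| <= a x + b y).

Let c_cont : continuous c.
Proof. by move=> z; apply: differentiable_continuous; exact: c_C1.1. Qed.

Definition average (f g : E -> \bar R) : E -> \bar R :=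
  fun x => (2^-1%:E * (f x + g x))%E.

Lemma average_integral (nu : probability (borel E) R) (f g : E -> \bar R) :
  nu.-integrable [set: E] f -> nu.-integrable [set: E] g ->
  nu.-integrable [set: E] (average f g) /\
  (\int[nu]_x average f g x = 2^-1%:E * (\int[nu]_x f x + \int[nu]_x g x))%E.
Proof.
move=> fi gi; have fgi : nu.-integrable [set: E] (f \+ g)%E by exact: integrableD.
split; first exact: integrableZl.
by rewrite /average integralZl// integralD.
Qed.

Lemma average_optimiser phi0 psi0 phi1 psi1 :
  dual_optimiser c rho mu phi0 psi0 -> dual_optimiser c rho mu phi1 psi1 ->
  dual_optimiser c rho mu (average phi0 phi1) (average psi0 psi1).
Proof.
move=> [adm0 opt0] [adm1 opt1].
have [[i0 y0] [j0 z0] pp0] := adm0; have [[i1 y1] [j1 z1] pp1] := adm1.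
have [iphi vphi] := average_integral i0 i1.
have [ipsi vpsi] := average_integral j0 j1.
have avg_lty (f g : E -> \bar R) x : (f x < +oo -> g x < +oo ->
    average f g x < +oo)%E.
  rewrite /average; case: (f x) => [r| |]//; case: (g x) => [s| |]// _ _;
    by rewrite /= ?addeNy ?addNye ?gt0_muleNy ?lte_fin ?invr_gt0// ltry.
have v01 : dual_value rho mu phi0 psi0 = dual_value rho mu phi1 psi1.
  by apply/eqP; rewrite eq_le opt1// opt0.
split; first split => //.
- by split => // x; exact: avg_lty.
- by split => // x; exact: avg_lty.
- move=> x y; rewrite /average; move: (pp0 x y) (pp1 x y) (y0 x) (y1 x) (z0 y) (z1 y).
  case: (phi0 x) => [r0| |]//; case: (phi1 x) => [r1| |]//;
  case: (psi0 y) => [s0| |]//; case: (psi1 y) => [s1| |]// p0 p1 _ _ _ _;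
  rewrite /= ?addeNy ?addNye ?gt0_muleNy ?lte_fin ?invr_gt0// ?addeNy ?addNye ?leNye//.
  by move: p0 p1; rewrite -!EFinD !lee_fin; lra.
- move=> phi' psi' /opt0; congr (_ <= _)%E.
  rewrite [RHS]/dual_value vphi vpsi.
  have : dual_value rho mu phi0 psi0 = dual_value rho mu phi1 psi1 by [].
  rewrite /dual_value.
  rewrite -(fineK (integrable_fin_num measurableT i0)).
  rewrite -(fineK (integrable_fin_num measurableT i1)).
  rewrite -(fineK (integrable_fin_num measurableT j0)).
  rewrite -(fineK (integrable_fin_num measurableT j1)).
  by rewrite -!EFinD => -[h]; congr EFin; lra.
Qed.

(** By continuity, the c-transform of the averaged pair equals the average of [F0] and [F1] on the
    whole support of [rho]. A near-minimiser for it at [x] is then nearly optimal for both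
    potentials, and compactness of [K] removes the error. *)
Lemma common_contact phi0 psi0 phi1 psi1 F0 F1 :
  dual_optimiser c rho mu phi0 psi0 -> dual_optimiser c rho mu phi1 psi1 ->
  is_ctransform c K psi0 F0 -> is_ctransform c K psi1 F1 ->
  {ae rho, forall x, phi0 x = (F0 x)%:E} ->
  {ae rho, forall x, phi1 x = (F1 x)%:E} ->
  forall x, S x -> exists2 y, K y & forall z,
     F0 z - F0 x <= c (z, y) - c (x, y) /\
     F1 z - F1 x <= c (z, y) - c (x, y).
Proof.
move=> opt0 opt1 cF0 cF1 ae0 ae1 x Sx.
have optb := average_optimiser opt0 opt1.
have [F [cF phiF]] := ctransform_exists cK b_usc c_le optb.1.
have aeF := dual_optimiser_ctransform c_cont cK b_usc a_L1 c_le optb cF phiF.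
have Fx : F x = 2^-1 * F0 x + 2^-1 * F1 x.
  apply: (@ae_eq_spt _ _ rho _ (fun z => 2^-1 * F0 z + 2^-1 * F1 z)) => //.
  - exact: is_ctransform_continuous cF.
  - by apply: continuous_lincomb; [exact: (is_ctransform_continuous c_cont cK cF0)|
      exact: (is_ctransform_continuous c_cont cK cF1)].
  - move: aeF; apply: ae_imp2 (ae_imp2 _ ae0 ae1).
      by move=> z; apply.
    move=> z h0 h1; rewrite /average h0 h1 => h.
    by move: h; rewrite -EFinD -EFinM => -[<-]; rewrite mulrDr.
(* [psi0] and [psi1] have been eliminated, so that passing to the limit in [y] uses only the
   continuity of [c]. The independent points [z] and [z'] separate the two contacts at the end, by
   setting one of them to [x]. *)
pose Q e y := forall z z', F0 z - F0 x + (F1 z' - F1 x) <=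
  c (z, y) + c (z', y) - 2 * c (x, y) + e.
have Qe e : 0 < e -> exists2 y, K y & Q e y.
  move=> e0; have e2 : 0 < e / 2 by rewrite divr_gt0.
  (* The error is halved because the averaged inequality gets multiplied by 2. *)
  have [y [Ky yf yP]] := cF.2 x _ e2; exists y => // z z'.
  have [_ [_ psi0y] _] := opt0.1; have [_ [_ psi1y] _] := opt1.1.
  move: yf yP (cF0.1 z y Ky) (cF1.1 z' y Ky) (psi0y y) (psi1y y).
  rewrite Fx /average; case: (psi0 y) => [s0| |]//; case: (psi1 y) => [s1| |]//.
  - by rewrite /= -!EFinD !lee_fin; lra.
  - by rewrite addeNy gt0_muleNy ?lte_fin ?invr_gt0.
  - by rewrite addNye gt0_muleNy ?lte_fin ?invr_gt0.
  - by rewrite addNye gt0_muleNy ?lte_fin ?invr_gt0.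
have [y Ky Qy] : exists2 y, K y & Q 0 y.
  (* Failure of [Q 0] at [y] persists as failure of [Q e] at nearby points for small [e]. By
     compactness some [Q e] with [e > 0] would then fail on all of [K], against [Qe]. *)
  apply: contrapT => /forall2NP nQ.
  have H : \forall e \near (0 : R)^'+, K `<=` (fun y => ~ Q e y).
    move/compact_near_coveringP : (cK) => cover.
    apply: (cover _ (0 : R)^'+ (fun e y => ~ Q e y)) => y Ky.
    have [//|/existsNP[z /existsNP[z' /negP]]] := nQ y; rewrite -ltNge addr0 => zz.
    pose g y := 1 * (1 * c (z, y) + 1 * c (z', y)) + - 2 * c (x, y).
    have gc : continuous g.
      have cc z0 : continuous (fun y => c (z0, y)).
        exact: continuous_pairr.
      apply: continuous_lincomb; last exact: cc.
      by apply: continuous_lincomb; exact: cc.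
    pose del := (F0 z - F0 x + (F1 z' - F1 x) - g y) / 2.
    have del0 : 0 < del by rewrite divr_gt0// subr_gt0 /g; lra.
    exists ([set y' | g y' < g y + del], [set e | e < del]) => /=.
      split; last exact: nbhs_right_lt.
      have /cvgrPdist_lt/(_ _ del0) := gc y; apply: filterS => y' /ltr_normlP[h1 h2] /=.
      by move: h1 h2; set u := g y; set v := g y'; lra.
    move=> [y' e] /= [h1 h2] /(_ z z').
    by move: h1 h2; rewrite /del /g; lra.
  have [e [e0 eP]] : exists e, 0 < e /\ K `<=` (fun y => ~ Q e y).
    apply: (@filter_ex _ (0 : R)^'+); near=> e; split; near: e => //.
    exact: nbhs_right_gt.
  by have [y Ky] := Qe e e0; exact: eP.
exists y => // z; split.
  by have := Qy z x; lra.
by have := Qy x z; lra.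
Unshelve. all: by end_near. Qed.

Lemma potential_diff_cst phi0 psi0 phi1 psi1 F0 F1 :
  dual_optimiser c rho mu phi0 psi0 -> dual_optimiser c rho mu phi1 psi1 ->
  is_ctransform c K psi0 F0 -> is_ctransform c K psi1 F1 ->
  {ae rho, forall x, phi0 x = (F0 x)%:E} ->
  {ae rho, forall x, phi1 x = (F1 x)%:E} ->
  forall x x', S x -> S x' -> F0 x - F1 x = F0 x' - F1 x'.
Proof.
move=> opt0 opt1 cF0 cF1 ae0 ae1 x x' Sx Sx'.
have contact := common_contact opt0 opt1 cF0 cF1 ae0 ae1.
have [w [acw wS w0 w1]] := rho_conn Sx Sx'.
have [tau [C [C0 tau01 lip t0 t1]]] := absolutely_continuous_reparam acw.
(* The contact condition is symmetric in the two potentials, so this one-sided estimate applied in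
   both orders yields equality. *)
have H (F G : E -> R) : (forall x, S x -> exists2 y, K y & forall z,
     F z - F x <= c (z, y) - c (x, y) /\ G z - G x <= c (z, y) - c (x, y)) ->
    F x - G x <= F x' - G x'.
  move=> FG; have := @potential_diff_le_along_curve _ _ c K F G (w \o tau) C c_C1 cK C0 lip.
  rewrite /= t0 t1 w0 w1; apply => t t01; apply: FG; apply: wS; exact: tau01.
have h1 := H F0 F1 contact.
have h2 : F1 x - F0 x <= F1 x' - F0 x'.
  by apply: H => z /contact[y Ky yP]; exists y => // u; have [] := yP u.
lra.
Qed.

(** On the support of [rho], [F0 = F1 + l], so [psi1 - l] satisfies the constraint with [F0], and so
    does its maximum with [psi0]. Optimality then forces this maximum to equal [psi0] a.e. *)
Lemma second_potential_le phi0 psi0 phi1 psi1 F0 F1 (l : R) :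
  dual_optimiser c rho mu phi0 psi0 -> dual_admissible c rho mu phi1 psi1 ->
  is_ctransform c K psi0 F0 -> is_ctransform c K psi1 F1 ->
  {ae rho, forall x, phi0 x = (F0 x)%:E} ->
  (forall x, S x -> F0 x - F1 x = l) ->
  {ae mu, forall y, (psi1 y - l%:E <= psi0 y)%E}.
Proof.
move=> opt0 adm1 cF0 cF1 ae0 Fl.
have [[iphi0 _] [ipsi0 psi0y] _] := opt0.1; have [_ [ipsi1 psi1y] _] := adm1.
pose h y := (psi1 y - l%:E)%E.
have ih : mu.-integrable [set: E] h.
  by apply: integrableB => //; exact: finite_measure_integrable_cst.
pose G y := maxe (psi0 y) (h y).
have iG : mu.-integrable [set: E] G.
  apply: (@le_integrable _ _ _ mu _ _ _ ((abse \o psi0) \+ (abse \o h))%E) => //.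
  - by apply: measurable_maxe; [exact: (measurable_int mu)|exact: (measurable_int mu)].
  - move=> y _; rewrite /G /= [leRHS]gee0_abs ?adde_ge0//.
    by rewrite maxEle; case: ifP => _; [rewrite leeDr|rewrite leeDl].
  - by apply: integrableD => //; exact: integrable_abse.
have iF0 := is_ctransform_integrable c_cont cK b_usc a_L1 c_le cF0.
have : (dual_value rho mu (EFin \o F0) G <= dual_value rho mu phi0 psi0)%E.
  apply: (dual_optimiser_ge opt0) => //.
  - by move=> x _; exact: ltry.
  - move=> y _; rewrite /G gt_max psi0y /h.
    by move: (psi1y y); case: (psi1 y) => [s| |]// _; rewrite ?ltry ?ltNyr.
  - move=> x y Sx Ky; rewrite /G maxEle; case: ifP => _; last exact: cF0.1.
    rewrite /h; have := cF1.1 x y Ky; have := Fl x Sx.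
    case: (psi1 y) => [s| |]//= e.
    by rewrite -!EFinD !lee_fin; lra.
have -> : dual_value rho mu (EFin \o F0) G = dual_value rho mu phi0 G.
  congr (_ + _)%E; apply: ae_eq_integral => //.
  - exact: (measurable_int rho iF0).
  - exact: (measurable_int rho iphi0).
  - by apply: ae_imp ae0 => x ->.
rewrite /dual_value leeD2lE ?(integrable_fin_num _ iphi0)// => Gle.
have : {ae mu, forall y, (psi0 y <= G y)%E} by apply: aeW => y; rewrite le_max lexx.
move=> /(ae_eq_of_integral_le iG ipsi0)/(_ Gle).
by apply: ae_imp => y <-; rewrite le_max lexx orbT.
Qed.

Lemma dual_optimiser_unique phi0 psi0 phi1 psi1 :
  dual_optimiser c rho mu phi0 psi0 -> dual_optimiser c rho mu phi1 psi1 ->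
  exists l : R, {ae rho, forall x, (phi0 x - phi1 x = l%:E)%E} /\
                {ae mu, forall y, (psi0 y - psi1 y = (- l)%:E)%E}.
Proof.
move=> opt0 opt1.
have [F0 [cF0 le0]] := ctransform_exists cK b_usc c_le opt0.1.
have [F1 [cF1 le1]] := ctransform_exists cK b_usc c_le opt1.1.
have ae0 := dual_optimiser_ctransform c_cont cK b_usc a_L1 c_le opt0 cF0 le0.
have ae1 := dual_optimiser_ctransform c_cont cK b_usc a_L1 c_le opt1 cF1 le1.
have [x0 Sx0] := spt_neq0 rho.
pose l := F0 x0 - F1 x0; exists l.
have Fl x : S x -> F0 x - F1 x = l.
  by move=> Sx; exact: (potential_diff_cst opt0 opt1 cF0 cF1 ae0 ae1).
split.
  apply: ae_imp2 (spt_full rho) (ae_imp2 _ ae0 ae1); last first.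
    by move=> x; exact: conj.
  by move=> x Sx [-> ->]; rewrite -EFinB Fl.
have h0 := second_potential_le opt0 opt1.1 cF0 cF1 ae0 Fl.
(* Exchanging the two pairs changes the sign of [l]. *)
have h1 : {ae mu, forall y, (psi0 y - (- l)%:E <= psi1 y)%E}.
  apply: (second_potential_le opt1 opt0.1 cF1 cF0 ae1) => x /Fl <-.
  by rewrite opprB.
have [_ [ipsi0 _] _] := opt0.1; have [_ [ipsi1 _] _] := opt1.1.
have f0 := integrable_ae measurableT ipsi0.
have f1 := integrable_ae measurableT ipsi1.
have h01 := ae_imp2 (fun y => @conj _ _) h0 h1.
have f01 := ae_imp2 (fun y => @conj _ _) f0 f1.
apply: ae_imp2 h01 f01 => y [h h'] [/(_ I) f /(_ I) f'].
move: h h'; rewrite -(fineK f) -(fineK f') -!EFinB !lee_fin => h h'.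
by congr EFin; lra.
Qed.

End uniqueness.

Theorem theorem1p2 (R : realType) (d : nat)
    (rho mu : probability (borel 'rV[R]_d) R)
    (c : 'rV[R]_d * 'rV[R]_d -> R) (a b : 'rV[R]_d -> R)
    (rho_conn : rectifiably_connected (spt rho))
    (mu_bounded : bounded_set (spt mu))
    (c_C1 : C1 c)
    (a_usc : upper_semicontinuous a) (b_usc : upper_semicontinuous b)
    (a_L1 : rho.-integrable [set: 'rV[R]_d] (EFin \o a))
    (b_L1 : mu.-integrable [set: 'rV[R]_d] (EFin \o b))
    (c_le : forall x y, `|c (x, y)| <= a x + b y) :
  (exists phi psi : 'rV[R]_d -> \bar R, dual_optimiser c rho mu phi psi) /\
  (forall phi0 psi0 phi1 psi1 : 'rV[R]_d -> \bar R,
     dual_optimiser c rho mu phi0 psi0 -> dual_optimiser c rho mu phi1 psi1 ->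
     exists l : R,
       {ae rho, forall x, (phi0 x - phi1 x = l%:E)%E} /\
       {ae mu, forall y, (psi0 y - psi1 y = (- l)%:E)%E}).
Proof.
have cK : compact (spt mu).
  by apply: bounded_closed_compact => //; exact: spt_closed.
have c_cont : continuous c.
  by move=> z; apply: differentiable_continuous; exact: c_C1.1.
split; first exact: (dual_optimiser_exists c_cont cK b_usc a_L1 b_L1 c_le).
exact: (dual_optimiser_unique rho_conn cK c_C1 b_usc a_L1 c_le).
Qed.
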